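(* Fix $d\ge1$. For all partitions $\mu\subseteq\lambda$ with $\ell(\lambda)\le d$ (set $\lambda_i=0$ for $i>\ell(\lambda)$), as rational functions in $\beta,q$, $$\sum_{T\in\operatorname{SIT}(\lambda/\mu)}\prod_{k=1}^{m(T)}\left(\left[\prod_{i=1}^d\frac{1+\beta q^{\nu_i(T_{<k})+d-i+1}}{1+\beta q^{\lambda_i+d-i+1}}\right]-1\right)^{-1}=\sum_{D\in\mathcal D(\lambda/\mu)}\beta^{|D|-|\lambda|}\prod_{(i,j)\in\lambda\setminus D}\frac{\beta q^{\lambda_i+d-i+1}+1}{q^{d+j-\lambda'_j}\big(1-q^{h(i,j)}\big)}.$$
   Context: Partitions are identified with Young diagrams $\{(i,j):1\le j\le\lambda_i\}$ (English convention); $\lambda'$ is the conjugate, $h(i,j)=\lambda_i-j+\lambda'_j-i+1$ the hook length in $\lambda$, $|\cdot|$ counts cells. A standard increasing tableau of shape $\lambda/\mu$ is a filling $T$ of the cells of $\lambda/\mu$ by positive integers, strictly increasing along rows and down columns, with set of entries $\{1,\dots,m\}$ for some $m=m(T)$; $\operatorname{SIT}(\lambda/\mu)$ is their set. $\nu(T_{<k})$ is the partition whose diagram is $\mu$ together with the cells of $\lambda/\mu$ with entry $<k$, with parts $\nu_i(T_{<k})$. Generalized excited diagrams: for $S\subseteq\lambda$, a cell $(i,j)\in S$ is active if $(i+1,j),(i,j+1),(i+1,j+1)\in\lambda\setminus S$; for active $(i,j)$ the type I move replaces $(i,j)$ by $(i+1,j+1)$ and the type II move adds $(i+1,j+1)$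 to $S$. $\mathcal D(\lambda/\mu)$ is the set of subsets of $\lambda$ obtainable from the diagram of $\mu$ by sequences of type I and II moves. *)

(* Defs.v *)
From mathcomp Require Import all_boot all_order all_algebra.
Unset Printing Implicit Defensive.
Import Order.TTheory GRing.Theory Num.Theory.

(* Partitions: weakly decreasing sequences of positive naturals;
   lambda_i = nth 0 la (i-1). Cells are stored 0-indexed:
   the cell (r, s) of the grid stands for the paper's (i,j) = (r+1, s+1). *)
Definition is_part (la : seq nat) : bool :=
  sorted geq la && all (fun x => 0 < x) la.

Definition subpart (mu la : seq nat) : bool :=
  (size mu <= size la) && all (fun i => nth 0 mu i <= nth 0 la i) (iota 0 (size mu)).

Definition conjp (la : seq nat) (j : nat) : nat := count (fun x => j <= x) la.

(* hook length h(i,j) = lambda_i - j + lambda'_j - i + 1 (1-indexed i, j) *)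
Definition hook (la : seq nat) (i j : nat) : nat :=
  (nth 0 la i.-1 - j) + (conjp la j - i) + 1.

Section Combinatorics.
Variables (d : nat) (la mu : seq nat).

(* ambient grid containing the diagram of la when size la <= d *)
Definition cell : finType := ('I_d * 'I_(nth 0 la 0))%type.

Definition in_la (c : cell) : bool := c.2 < nth 0 la c.1.
Definition in_mu (c : cell) : bool := c.2 < nth 0 mu c.1.
Definition in_skew (c : cell) : bool := in_la c && ~~ in_mu c.

(* A filling is a finite function cell -> 'I_N (N exceeds the number of
   cells, so every SIT is represented); cells outside la/mu get 0. *)
Definition NSIT : nat := (d * nth 0 la 0).+1.
Definition filling := {ffun cell -> 'I_NSIT}.

Definition mSIT (T : filling) : nat := \max_(c | in_skew c) val (T c).

Definition is_SIT (T : filling) : bool :=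
  [forall c, ~~ in_skew c ==> (val (T c) == 0)] &&
  [forall c, in_skew c ==> (0 < val (T c))] &&
  [forall c, forall c', (in_skew c && in_skew c' && (c.1 == c'.1) && (c.2 < c'.2))
                        ==> (val (T c) < val (T c'))] &&
  [forall c, forall c', (in_skew c && in_skew c' && (c.2 == c'.2) && (c.1 < c'.1))
                        ==> (val (T c) < val (T c'))] &&
  [forall k : 'I_NSIT, ((1 <= val k) && (val k <= mSIT T)) ==>
                       [exists c, in_skew c && (T c == k)]].

Definition nuT (T : filling) (k : nat) (r : 'I_d) : nat :=
  nth 0 mu r + #|[set c : cell | in_skew c && (c.1 == r) && (val (T c) < k)]|.

Definition la_at (i j : nat) : bool := (i < d) && (j < nth 0 la i).
Definition mem_at (S : {set cell}) (i j : nat) : bool :=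
  [exists c in S, (val c.1 == i) && (val c.2 == j)].
Definition free_at (S : {set cell}) (i j : nat) : bool :=
  la_at i j && ~~ mem_at S i j.

Definition active (S : {set cell}) (c : cell) : bool :=
  (c \in S) && free_at S c.1.+1 c.2 && free_at S c.1 c.2.+1
  && free_at S c.1.+1 c.2.+1.

Definition exc_step : rel {set cell} := fun S S' =>
  [exists c in S, active S c &&
     [exists c' : cell, (val c'.1 == c.1.+1) && (val c'.2 == c.2.+1) &&
        ((S' == c' |: (S :\ c)) || (S' == c' |: S))]].

Definition mu_set : {set cell} := [set c | in_mu c].

Definition excited : {set {set cell}} := [set D | connect exc_step mu_set D].

End Combinatorics.

Definition RF := {fraction {poly {poly rat}}}.
Definition beta : RF := tofrac ('X%:P : {poly {poly rat}}).
Definition qv : RF := tofrac ('X : {poly {poly rat}}).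

(* Main.v *)
Require Import Defs.
From mathcomp Require Import all_boot all_order all_algebra.
From mathcomp Require Import zify ring.
Import Order.TTheory GRing.Theory Num.Theory.
Local Open Scope ring_scope.

(** Put [u_i = 1 + beta q^(la_i+d-i+1)] and [v_j = 1 + beta q^(d+j-la'_j)]. Since
    [q^(d+j-la'_j) q^h(i,j) = q^(la_i+d-i+1)], the factor of a cell on the right is
    [beta / (v_j/u_i - 1)], so up to the value at [mu = la] the right-hand side is
    [G(mu) = \sum_D \prod_(c in D) (v_j/u_i - 1)].

    Generalized excited diagrams are exactly the [D] contained in [la] whose
    reading word, letting each cell act by the 0-Hecke generator of its diagonal on
    partitions (add the box of that diagonal; fix the partition if it has a corner
    there; kill it otherwise), sends the empty partition to [mu].  Hence [G] obeys
    a recursion on [la]: adding a box on diagonal [k] swaps the parameters [z_k] and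
    [z_(k+1)], where [z_p = 1 + beta q^(p+1)], and applies [1 + (z_k/z_(k+1) - 1) T_k].
    This recursion, for arbitrary nonzero [z], yields by induction on [la] the
    Chevalley rule
    [\prod_r z(pos_r mu) G(mu) = \prod_r z(pos_r la) \sum_nu G(nu)],
    the sum being over all [nu] obtained from [mu] by adding a set of addable boxes.

    Removing the cells with entry 1 from an increasing tableau shows that the
    left-hand side satisfies the same recursion in [mu]. *)

(** * Hecke words and excited diagrams in a grid *)

Section Downsets.
Set Implicit Arguments.
Unset Strict Implicit.
Variables d n : nat.
Local Notation cell := ('I_d * 'I_n)%type.
Implicit Types (a b c e f : cell) (M S A L X mu nu : {set cell}) (R : seq cell).
Local Open Scope nat_scope.

Definition cle a b : bool := (a.1 <= b.1) && (a.2 <= b.2).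

(** The content [j - i] shifted by [d - 1], which makes it a natural number. It indexes the 0-Hecke
    generators. *)
Definition diag c : nat := c.2 + (d.-1 - c.1).

Definition downset M : bool :=
  [forall a, forall b, cle a b ==> (b \in M) ==> (a \in M)].

(** [downset M] is built in, so that one hypothesis carries the partition before and after the
    change; likewise for [corner]. *)
Definition addable M e : bool := [&& e \notin M, downset M & downset (e |: M)].
Definition corner M e : bool := [&& e \in M, downset M & downset (M :\ e)].

Lemma downsetP M :
  reflect (forall a b, cle a b -> b \in M -> a \in M) (downset M).
Proof.
apply: (iffP forallP) => [H a b le_ab bM | H a].
  by have /forallP/(_ b) := H a; rewrite le_ab bM.
by apply/forallP => b; apply/implyP => le_ab; apply/implyP; apply: H.
Qed.

Lemma cle_refl a : cle a a.
Proof. by rewrite /cle !leqnn. Qed.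

Lemma cle_trans b a c : cle a b -> cle b c -> cle a c.
Proof. by rewrite /cle; lia. Qed.

Lemma cell_eqE a b : (a == b) = (a.1 == b.1 :> nat) && (a.2 == b.2 :> nat).
Proof. by []. Qed.

Lemma cle_anti a b : cle a b -> cle b a -> a = b.
Proof. by rewrite /cle => ? ?; apply/eqP; rewrite cell_eqE; lia. Qed.

Lemma diag_comparable a b : diag a = diag b -> cle a b || cle b a.
Proof.
rewrite /diag /cle; case: a b => [[a1 ?] [a2 ?]] [[b1 ?] [b2 ?]] /=; lia.
Qed.

(** The condition [|k - l| >= 2], under which distinct 0-Hecke generators commute. *)
Definition far (k l : nat) : bool := (k.+1 < l) || (l.+1 < k).

Lemma far_irrefl k : far k k = false.
Proof. by rewrite /far; lia. Qed.

(** The witness is the right neighbour of [a], or the lower one if [a] and [b] share a column.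
    Between two cells of one diagonal it gives a cell of an adjacent diagonal, the source of most
    contradictions below. *)
Lemma cle_cover a b : cle a b -> a != b ->
  exists c, [/\ cle a c, cle c b, diag c != diag a & ~~ far (diag a) (diag c)].
Proof.
case: a b => [[a1 a1d] [a2 a2n]] [[b1 b1d] [b2 b2n]].
rewrite cell_eqE /cle /= => /andP[le1 le2] neq.
have [lt2|ge2] := ltnP a2 b2.
  exists (Ordinal a1d, Ordinal (leq_ltn_trans lt2 b2n)).
  by split; rewrite ?/far /diag /=; lia.
have lt1 : a1 < b1 by lia.
exists (Ordinal (leq_ltn_trans lt1 b1d), Ordinal a2n).
by split; rewrite ?/cle ?/far /diag /=; lia.
Qed.

Lemma downsetU M L : downset M -> downset L -> downset (M :|: L).
Proof.
move=> /downsetP dM /downsetP dL; apply/downsetP => a b le_ab.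
by rewrite !inE => /orP[/(dM _ _ le_ab)->|/(dL _ _ le_ab)->] //; rewrite orbT.
Qed.

Lemma downsetI M L : downset M -> downset L -> downset (M :&: L).
Proof.
move=> /downsetP dM /downsetP dL; apply/downsetP => a b le_ab.
by rewrite !inE => /andP[/(dM _ _ le_ab)-> /(dL _ _ le_ab)->].
Qed.

Lemma downset0 : downset set0.
Proof. by apply/downsetP => a b; rewrite !inE. Qed.

Lemma cornerW M e : corner M e -> (e \in M) * downset M * downset (M :\ e).
Proof. by case/and3P. Qed.

Lemma addableW M e : addable M e -> (e \notin M) * downset M * downset (e |: M).
Proof. by case/and3P. Qed.

Lemma corner_setU1 M e : addable M e -> corner (e |: M) e.
Proof. by move=> a; rewrite /corner setU11 setU1K !(addableW a). Qed.

Lemma addable_setD1 M e : corner M e -> addable (M :\ e) e.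
Proof. by move=> c; rewrite /addable setD11 setD1K !(cornerW c). Qed.

Lemma corner_max M e f : corner M e -> f \in M -> cle e f -> f = e.
Proof.
case/and3P => eM _ /downsetP dMe fM le_ef; apply/eqP; apply: contraT => ne.
by have := dMe _ _ le_ef; rewrite !inE ne fM eqxx => /(_ isT).
Qed.

Lemma maximal_corner M e : downset M -> e \in M ->
  (forall f, f \in M -> cle e f -> f = e) -> corner M e.
Proof.
move=> dM eM H; rewrite /corner eM dM; apply/downsetP => a b le_ab.
rewrite !inE => /andP[ne bM]; rewrite (downsetP _ dM _ _ le_ab bM) andbT.
by apply: contraNneq ne => ea; rewrite -(H b bM) // -ea.
Qed.

Lemma addable_diag_inj M e f :
  addable M e -> addable M f -> diag e = diag f -> e = f.
Proof.
move=> ae af def; wlog le : e f ae af def / cle e f.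
  move=> W; case/orP: (diag_comparable def) => le; first exact: W.
  by symmetry; apply: W.
case/and3P: ae => eM _ _; case/and3P: af => fM _ /downsetP dfM.
by have := dfM _ _ le; rewrite !inE eqxx (negPf eM) orbF => /(_ isT) /eqP.
Qed.

Lemma corner_diag_inj M e f :
  corner M e -> corner M f -> diag e = diag f -> e = f.
Proof.
move=> ce cf def; have [/and3P[eM _ _] /and3P[fM _ _]] := (ce, cf).
case/orP: (diag_comparable def) => le; last exact: (corner_max cf eM le).
by symmetry; apply: (corner_max ce fM le).
Qed.

(** This keeps the cases of the 0-Hecke action apart. If [f] precedes [e], the neighbour of [f] on
    the way to [e] lies in [M], so [f] is not maximal; if [e] precedes [f], then [e] is already in
    [M]. *)
Lemma addable_not_corner M e f :
  addable M e -> corner M f -> diag e <> diag f.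
Proof.
move=> /and3P[eM /downsetP dM /downsetP deM] cf def.
have [fM _ _] := and3P cf.
case/orP: (diag_comparable def) => le; first by rewrite (dM _ _ le fM) in eM.
have ne : f != e by apply: contraNneq eM => <-.
have [c [fc ce dc _]] := cle_cover le ne.
have cM : c \in M.
  have := deM _ _ ce; rewrite !inE eqxx => /(_ isT) /orP[/eqP ec|//].
  by rewrite ec def eqxx in dc.
by have ecf := corner_max cf cM fc; rewrite ecf eqxx in dc.
Qed.

(** Removing [f] can only expose cells covered by [f], and these lie on adjacent diagonals. This is
    the commutation of far generators, seen on corners. *)
Lemma corner_lift M e f : corner M f -> corner (M :\ f) e ->
  far (diag e) (diag f) -> corner M e.
Proof.
move=> cf ce far_ef; have [fM dM _] := and3P cf.
have := ce; rewrite /corner !inE => /andP[/andP[nef eM] _].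
apply: maximal_corner => // g gM eg.
have [egf|ngf] := eqVneq g f; last first.
  by apply: (corner_max ce) => //; rewrite !inE ngf.
rewrite egf in eg; have [c [ec cg dc nfar]] := cle_cover eg nef.
have cM : c \in M :\ f.
  rewrite !inE (downsetP _ dM c f) ?andbT //.
  by apply: contraNneq nfar => ->.
by have ece := corner_max ce cM ec; rewrite ece eqxx in dc.
Qed.

Lemma corner_del M e f : corner M e -> corner M f -> e != f ->
  corner (M :\ f) e.
Proof.
move=> /and3P[eM dM dMe] /and3P[fM _ dMf] ne; rewrite /corner !inE ne eM dMf /=.
rewrite (_ : _ :\ e = (M :\ e) :&: (M :\ f)); first exact: downsetI.
by apply/setP => g; rewrite !inE; case: (g \in M); rewrite ?andbF ?andbT.
Qed.

(* The head of [R] is the cell added last; rows are completed from top to bottom. *)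
Fixpoint growth R : bool :=
  if R is b :: R' then
    [&& growth R', addable [set x in R'] b & all (fun c => c.1 <= b.1) R']
  else true.

Lemma growth_cons b R : growth (b :: R) ->
  [/\ growth R, addable [set x in R] b & forall c, c \in R -> c.1 <= b.1].
Proof. by case/and3P => ? ? /allP. Qed.

Lemma growth_downset R : growth R -> downset [set x in R].
Proof.
case: R => [|b R] /=; first by rewrite set_nil downset0.
by case/and3P => _ a _; rewrite set_cons (addableW a).
Qed.

(** Cells are stripped from the lowest row upwards, each row from right to left: the last cell of
    the lowest nonempty row is always a corner. *)
Lemma growth_exists L : downset L -> exists2 R, growth R & [set x in R] = L.
Proof.
have [m] := ubnP #|L|; elim: m L => // m IH L ltL dL.
have [->|[a0 a0L]] := set_0Vmem L; first by exists nil; rewrite ?set_nil.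
case: (arg_maxnP (fun c => nat_of_ord c.1) a0L) => a aL amax0.
have amax c : c \in L -> c.1 <= a.1 by apply: amax0.
have aP : (a \in L) && (a.1 == a.1) by rewrite eqxx andbT.
case: (@arg_maxnP _ a (fun c => (c \in L) && (c.1 == a.1)) (fun c => nat_of_ord c.2) aP).
move=> b /andP[bL /eqP b1] bmax0.
have bmax c : c \in L -> c.1 == a.1 -> c.2 <= b.2.
  by move=> cL c1; apply: bmax0; rewrite cL c1.
have cb : corner L b.
  apply: maximal_corner => // f fL; rewrite /cle => /andP[le1 le2].
  have f1 : f.1 == a.1 by rewrite -val_eqE /= eqn_leq -{2}b1 le1 amax.
  apply: cle_anti; last by rewrite /cle le1 le2.
  by rewrite /cle (eqP f1) b1 leqnn bmax.
have [|R gR eR] := IH (L :\ b) _ (cornerW cb).2.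
  by rewrite (cardsD1 b L) bL in ltL.
exists (b :: R); last by rewrite set_cons eR setD1K.
rewrite /= gR eR addable_setD1 //; apply/allP => c cR.
have : c \in L :\ b by rewrite -eR inE.
by rewrite inE b1 => /andP[_ /amax].
Qed.

(* [mu] and [mu :\ e] are the two partitions sent to [mu] by the 0-Hecke generator of
   the diagonal of the corner [e]. *)
Fixpoint hecke R S mu : bool :=
  if R is b :: R' then
    if b \in S then
      [exists e, [&& corner mu e, diag e == diag b &
        hecke R' (S :\ b) mu || hecke R' (S :\ b) (mu :\ e)]]
    else hecke R' S mu
  else (S == set0) && (mu == set0).

Lemma hecke_consP b R S mu : b \in S ->
  reflect (exists2 e, corner mu e /\ diag e = diag b &
      exists2 nu, nu = mu \/ nu = mu :\ e & hecke R (S :\ b) nu)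
    (hecke (b :: R) S mu).
Proof.
move=> bS; rewrite /= bS; apply: (iffP existsP) => -[e].
  case/and3P => ce /eqP de /orP[h|h]; exists e => //.
    by exists mu => //; left.
  by exists (mu :\ e) => //; right.
case=> ce de [nu [->|->] h]; exists e; rewrite ce de eqxx h //.
by rewrite orbT.
Qed.

Lemma hecke_sub R S mu : hecke R S mu -> S \subset [set x in R].
Proof.
elim: R S mu => [|b R IH] S mu; first by move=> /= /andP[/eqP-> _]; apply: sub0set.
have [bS|bS] := boolP (b \in S).
  case/(hecke_consP _ _ bS) => e _ [nu _ /IH]; rewrite set_cons => sub.
  by rewrite -(setD1K bS) setUS.
by rewrite /= (negPf bS) set_cons => /IH sub; apply: subset_trans (subsetUr _ _).
Qed.

Lemma hecke_notin R S mu c : hecke R S mu -> c \notin R -> c \notin S.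
Proof. by move=> /hecke_sub/subsetP sub; apply: contra => /sub; rewrite inE. Qed.

(** The corner [e] cannot lie strictly beyond [b] on their diagonal, since then [b] would belong to
    [M :\ e] and so to [L]. *)
Lemma corner_sub_addable L M b e : addable L b -> corner M e ->
  diag e = diag b -> M :\ e \subset L -> M \subset b |: L.
Proof.
case/and3P => bL _ /downsetP dbL ce de sub.
suff eb : e \in b |: L.
  by rewrite -(setD1K (cornerW ce).1.1) subUset sub1set eb subsetU // sub orbT.
case/orP: (diag_comparable de) => le; first by apply: dbL le _; rewrite setU11.
have [<-|ne] := eqVneq b e; first by rewrite setU11.
have /(subsetP sub) : b \in M :\ e.
  by rewrite !inE ne; apply: downsetP (cornerW ce).1.2 _ _ le (cornerW ce).1.1.
by rewrite (negPf bL).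
Qed.

Lemma hecke_shape R S mu : growth R -> hecke R S mu ->
  downset mu /\ mu \subset [set x in R].
Proof.
elim: R S mu => [|b R IH] S mu.
  by move=> /= _ /andP[_ /eqP->]; rewrite downset0 sub0set.
case/growth_cons => gR ab _; have [bS|bS] := boolP (b \in S).
  case/(hecke_consP _ _ bS) => e [ce de] [nu enu /(IH _ _ gR) [_ sub]].
  rewrite (cornerW ce); split => //; rewrite set_cons.
  apply: corner_sub_addable ab ce de _; case: enu sub => -> // sub.
  exact: subset_trans (subD1set _ _) sub.
rewrite /= (negPf bS) set_cons => /(IH _ _ gR) [-> sub]; split => //.
exact: subset_trans sub (subsetUr _ _).
Qed.

(** The 0-Hecke generators act as partial functions. In the mixed cases the common predecessor would
    have both a corner and an addable cell on the diagonal of [b]. *)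
Lemma hecke_inj R S mu nu : hecke R S mu -> hecke R S nu -> mu = nu.
Proof.
elim: R S mu nu => [|b R IH] S mu nu.
  by move=> /= /andP[_ /eqP->] /andP[_ /eqP->].
have [bS|bS] := boolP (b \in S); last by rewrite /= (negPf bS); apply: IH.
case/(hecke_consP _ _ bS) => e [ce de] [x ex hx].
case/(hecke_consP _ _ bS) => f [cf df] [y ey hy].
have exy := IH _ _ _ hx hy; rewrite -{y hy}exy in ey.
case: ex ey => -> [E|E]; first by [].
- have := addable_setD1 cf; rewrite -E => a.
  by case: (addable_not_corner a ce); rewrite df de.
- have := addable_setD1 ce; rewrite E => a.
  by case: (addable_not_corner a cf); rewrite df de.
have ef : e = f.
  apply: (addable_diag_inj (addable_setD1 ce)); last by rewrite df.
  by rewrite E; apply: addable_setD1.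
by rewrite -(setD1K (cornerW ce).1.1) E ef setD1K // (cornerW cf).
Qed.

(* A letter that commutes with all later letters may be read last. *)
Lemma hecke_move R S mu a : growth R -> hecke R S mu -> a \in S ->
    (forall c, c \in S -> a.1 <= c.1 -> ~~ cle c a -> far (diag a) (diag c)) ->
  exists2 e, corner mu e /\ diag e = diag a &
    hecke R (S :\ a) mu || hecke R (S :\ a) (mu :\ e).
Proof.
elim: R S mu => [|b R IH] S mu; first by move=> _ /= /andP[/eqP->]; rewrite inE.
case/growth_cons => gR ab rows h aS farS.
have aR : a \in b :: R by have /subsetP/(_ a aS) := hecke_sub h; rewrite inE.
have [eba|nba] := eqVneq a b.
  rewrite -{}eba in h *; case/(hecke_consP _ _ aS): h => e ce [nu enu h].
  by exists e => //=; rewrite setD11; case: enu h => -> ->; rewrite ?orbT.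
have [bS|bS] := boolP (b \in S); last first.
  rewrite /= (negPf bS) in h; have [e ce h'] := IH _ _ gR h aS farS.
  by exists e => //=; rewrite !inE (negPf bS) andbF.
rewrite inE (negPf nba) /= in aR.
(* A letter read after [a] lies in the row of [a] or lower, and not weakly before [a] in the order
   [cle], so [farS] applies to it. *)
have far_ab : far (diag a) (diag b).
  apply: farS bS (rows _ aR) _; apply: contraNN (addableW ab).1.1 => le.
  by apply: (downsetP _ (growth_downset gR) _ _ le); rewrite inE.
case/(hecke_consP _ _ bS): h => f [cf df] [nu enu h].
have [||e [ce de] h'] := IH _ _ gR h; first by rewrite !inE nba.
  by move=> c; rewrite !inE => /andP[_ cS]; apply: farS.
have cme : corner mu e.
  case: enu ce => -> // ce; apply: corner_lift cf ce _.
  by rewrite de df.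
have nef : e != f by apply: contraTneq far_ab => ef; rewrite -de -df ef far_irrefl.
exists e => //=; have bSa : b \in S :\ a by rewrite !inE eq_sym nba.
have CD : (S :\ a) :\ b = (S :\ b) :\ a by rewrite !setDDl setUC.
have CD' : (mu :\ e) :\ f = (mu :\ f) :\ e by rewrite !setDDl setUC.
case/orP: h' => h'; apply/orP; [left|right].
  apply/(hecke_consP _ _ bSa); exists f; first by [].
  by exists nu; rewrite ?CD.
apply/(hecke_consP _ _ bSa); exists f.
  by split=> //; apply: corner_del => //; rewrite eq_sym.
exists (nu :\ e); last by rewrite CD.
by rewrite CD'; case: enu => ->; [left|right].
Qed.

(** * Excited moves preserve the image of a Hecke word *)

Definition estep L : rel {set cell} := fun S S' =>
  [exists a in S, exists b in L,
    [&& b.1 == a.1.+1 :> nat, b.2 == a.2.+1 :> nat,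
        [forall c in S, cle a c ==> cle c b ==> (c == a)] &
        (S' == b |: (S :\ a)) || (S' == b |: S)]].

Lemma estepP L S S' :
  reflect (exists a b, [/\ a \in S, b \in L,
      b.1 = a.1.+1 :> nat /\ b.2 = a.2.+1 :> nat,
      forall c, c \in S -> cle a c -> cle c b -> c = a &
      S' = b |: (S :\ a) \/ S' = b |: S])
    (estep L S S').
Proof.
apply: (iffP exists_inP) => [[a aS /exists_inP[b bL]]|[a [b [aS bL [e1 e2] H E]]]].
  case/and4P => /eqP e1 /eqP e2 /forall_inP H E; exists a, b; split => //.
    by move=> c cS ac cb; have := H c cS; rewrite ac cb => /eqP.
  by case/orP: E => /eqP; [left|right].
exists a => //; apply/exists_inP; exists b; rewrite // e1 e2 !eqxx /=.
apply/andP; split; last by case: E => ->; rewrite eqxx ?orbT.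
apply/forall_inP => c cS; apply/implyP => ac; apply/implyP => cb.
exact/eqP/H.
Qed.

(** When [x] is the last letter, [a] commutes past all letters after it and can be read in place of
    [x], which has the same diagonal. So a type I move only reorders the word, and a type II move
    repeats a letter, harmless because 0-Hecke generators are idempotent. Other last letters are
    peeled off by induction. *)
Lemma hecke_estep R S S' mu : growth R -> estep [set x in R] S S' ->
  hecke R S mu -> hecke R S' mu.
Proof.
move=> gR /estepP[a [x [aS xR [x1 x2] H E]]].
elim: R S S' mu gR aS xR H E => [|b R IH] S S' mu; first by rewrite !inE.
case/growth_cons => gR ab rows aS xR H E h.
have ax : cle a x by rewrite /cle x1 x2 !leqnSn.
have nxa : x != a by apply: contra_eqN x1 => /eqP->; rewrite neq_ltn ltnSn.
have xS : x \notin S by apply: contraNN nxa => xS; rewrite (H x) ?cle_refl.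
have [exb|nxb] := eqVneq x b.
  rewrite -exb in h ab rows *; rewrite /= (negPf xS) in h.
  have [|e [ce de] h'] := @hecke_move R S mu a gR h aS.
    (* The row order bounds the row of [c] by that of [x]. In the row of [a], [c] is at least two
       columns to the right of [a]; in the row of [x], it is strictly left of the column of [a], as
       no cell of [R] lies weakly beyond [x]. Both put it on a far diagonal. *)
    move=> c cS ac1; have := H c cS.
    have /subsetP/(_ c cS) := hecke_sub h; rewrite inE => cR.
    have cx : c.1 <= x.1 by apply: rows.
    have nxc : ~~ cle x c.
      apply: contraNN (addableW ab).1.1 => le.
      by apply: (downsetP _ (growth_downset gR) _ _ le); rewrite inE.
    move=> H' nca.
    have H'' : cle a c -> cle c x -> False.
      by move=> u v; case/negP: nca; rewrite (H' u v) cle_refl.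
    move: ac1 cx nxc H'' nca x1 x2; rewrite /cle /diag /far; clear.
    case: a c x => [[? ?] [? ?]] [[? ?] [? ?]] [[? ?] [? ?]] /=.
    by move=> ? ? ? H' ? ? ?; lia.
  have xS' : x \in S' by case: E => ->; rewrite setU11.
  have dax : diag a = diag x.
    by rewrite /diag x1 x2; have := ltn_ord x.1; rewrite x1; clear; lia.
  apply/(hecke_consP _ _ xS'); exists e; first by rewrite de.
  case: E => ->; rewrite setU1K ?inE ?(negPf xS) ?andbF //; last first.
    by exists mu => //; left.
  by case/orP: h'; [exists mu; first left | exists (mu :\ e); first right].
rewrite inE in_cons (negPf nxb) /= in xR.
have xR' : x \in [set x in R] by rewrite inE.
have aR : a \in [set x in R].
  exact: downsetP (growth_downset gR) _ _ ax xR'.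
have nab : a != b by apply: contraTneq aR => ->; rewrite (addableW ab).
have [bS|bS] := boolP (b \in S); last first.
  rewrite /= (negPf bS) in h.
  have bS' : b \notin S'.
    by case: E => ->; rewrite !inE (negPf bS) ?andbF orbF eq_sym.
  by rewrite /= (negPf bS'); apply: IH gR aS xR' H E h.
have bS' : b \in S' by case: E => ->; rewrite !inE bS ?andbT ?(eq_sym b a) ?nab orbT.
case/(hecke_consP _ _ bS): h => e cde [nu enu h].
apply/(hecke_consP _ _ bS'); exists e => //; exists nu => //.
apply: IH gR _ xR' _ _ h; first by rewrite !inE nab.
  by move=> c; rewrite !inE => /andP[_]; apply: H.
case: E => ->; [left|right]; rewrite setDUl; congr (_ :|: _).
- by apply/setP => c; rewrite !inE; case: (eqVneq c x) => [->|_]; rewrite ?nxb ?andbF.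
- by rewrite !setDDl setUC.
by apply/setP => c; rewrite !inE; case: (eqVneq c x) => [->|_]; rewrite ?nxb ?andbF.
Qed.

(** The last letter lying in [mu] is a corner of [mu], so every letter read adds exactly its own
    cell. *)
Lemma hecke_refl R mu : growth R -> downset mu -> mu \subset [set x in R] ->
  hecke R mu mu.
Proof.
elim: R mu => [|b R IH] mu.
  by rewrite set_nil subset0 /= => _ _ /eqP->; rewrite eqxx.
case/growth_cons => gR ab _ dmu sub; rewrite set_cons in sub.
have [bmu|bmu] := boolP (b \in mu); last first.
  rewrite /= (negPf bmu); apply: IH => //; apply/subsetP => c cmu.
  have /setU1P[cb|//] := subsetP sub c cmu.
  by rewrite cb (negPf bmu) in cmu.
have cb : corner mu b.
  apply: maximal_corner => // f fmu bf.
  have /setU1P[//|fR] := subsetP sub f fmu.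
  have := addableW ab; rewrite (downsetP _ (growth_downset gR) _ _ bf fR).
  by case=> [[]].
apply/(hecke_consP _ _ bmu); exists b => //; exists (mu :\ b); first by right.
apply: IH; rewrite ?(cornerW cb) //.
apply/subsetP => c /setD1P[ncb cmu].
by have /setU1P[cb'|//] := subsetP sub c cmu; rewrite cb' eqxx in ncb.
Qed.

(** * From Hecke words back to excited moves *)

Lemma connect_homo (T T' : finType) (e : rel T) (e' : rel T') (f : T -> T') x y :
  (forall x y, e x y -> e' (f x) (f y)) ->
  connect e x y -> connect e' (f x) (f y).
Proof.
move=> H /connectP[p]; elim: p x => [|z p IH] x /=; first by move=> _ ->.
case/andP => exz pzp ey; apply: connect_trans (IH _ pzp ey).
exact/connect1/H.
Qed.

(** The new cell [b] precedes no cell of [L], hence lies outside the square of any move inside [L]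
    and cannot obstruct it. *)
Lemma estep_carry b L S S' : downset L -> b \notin L ->
  estep L S S' -> estep (b |: L) (b |: S) (b |: S').
Proof.
move=> dL bL /estepP[a [x [aS xL [x1 x2] H E]]].
have nab : a != b.
  apply: contraNneq bL => <-; apply: downsetP dL _ _ _ xL.
  by rewrite /cle x1 x2 !leqnSn.
apply/estepP; exists a, x; split => //; try by rewrite !inE ?aS ?xL orbT.
  move=> c /setU1P[->|]; last exact: H.
  by move=> _ bx; case/negP: bL; apply: downsetP dL _ _ bx xL.
case: E => ->; [left|right]; last by rewrite setUCA.
rewrite setUCA; congr (_ |: _); apply/setP => c; rewrite !inE.
by case: (eqVneq c b) => // ->; rewrite eq_sym nab.
Qed.

Lemma estep_widen b L S S' : estep L S S' -> estep (b |: L) S S'.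
Proof.
move=> /estepP[a [x [aS xL x12 H E]]]; apply/estepP; exists a, x.
by split => //; rewrite !inE xL orbT.
Qed.

Lemma diag_next a b : cle a b -> diag a = diag b -> a != b ->
  exists a1 : cell, [/\ a1.1 = a.1.+1 :> nat, a1.2 = a.2.+1 :> nat,
    diag a1 = diag b & cle a1 b].
Proof.
case: a b => [[a1 ?] [a2 ?]] [[b1 b1d] [b2 b2n]].
rewrite cell_eqE /cle /diag /= => le de ne.
have l1 : a1.+1 < d by lia.
have l2 : a2.+1 < n by lia.
by exists (Ordinal l1, Ordinal l2); split => //=; lia.
Qed.

(** Repeated type I moves: as [X] has nothing weakly beyond [a], every square on the way is free. *)
Lemma slide L X a b : downset L -> b \in L -> diag a = diag b -> cle a b ->
    (forall c, c \in X -> ~~ cle a c) ->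
  connect (estep L) (a |: X) (b |: X).
Proof.
move=> dL bL; have [m] := ubnP (b.2 - a.2); elim: m a => // m IH a ltm dab le HX.
have [->|ne] := eqVneq a b; first exact: connect0.
have [x [x1 x2 dx xb]] := diag_next le dab ne.
have ax : cle a x by rewrite /cle x1 x2 !leqnSn.
have aX : a \notin X by apply/negP => /HX; rewrite cle_refl.
apply: (@connect_trans _ _ (x |: X)); last first.
  apply: IH => //; first by move: xb ltm; rewrite /cle x2; clear; lia.
  by move=> c /HX; apply: contra => xc; apply: cle_trans ax xc.
apply/connect1/estepP; exists a, x; split => //; first by rewrite setU11.
- exact: downsetP dL _ _ xb bL.
- by move=> c /setU1P[//|/HX/negP H /H].
by left; rewrite setU1K.
Qed.

(** By induction [S :\ b] is reached from the predecessor [nu] of [mu], with [b] carried along. It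
    remains to go from [mu] to [b |: nu]. If [nu = mu :\ e], the corner [e] slides to [b]; if
    [nu = mu], a type II move first copies [e] to the next cell of its diagonal, and the copy slides
    to [b]. *)
Lemma hecke_connect R S mu : growth R -> hecke R S mu ->
  connect (estep [set x in R]) mu S.
Proof.
elim: R S mu => [|b R IH] S mu.
  by move=> _ /= /andP[/eqP-> /eqP->]; apply: connect0.
move=> gbR; have [gR ab _] := growth_cons gbR; rewrite set_cons.
have dL := addableW ab.
have [bS|bS] := boolP (b \in S); last first.
  rewrite /= (negPf bS) => /(IH _ _ gR); apply: (@connect_homo _ _ _ _ id) => x y.
  exact: estep_widen.
move=> hb; have [_ sub] := hecke_shape gbR hb; rewrite set_cons in sub.
case/(hecke_consP _ _ bS): hb => e [ce de] [nu enu h].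
have [dnu subnu] := hecke_shape gR h.
have ebL : cle e b.
  case/orP: (diag_comparable de) => // be.
  have /setU1P[->|eL] := subsetP sub e (cornerW ce).1.1; first exact: cle_refl.
  by case/negP: dL.1.1; apply: downsetP dL.1.2 _ _ be eL.
have reach : connect (estep (b |: [set x in R])) (b |: nu) S.
  rewrite -(setD1K bS).
  apply: (connect_homo (e := estep [set x in R]) (f := fun A => b |: A)) (IH _ _ gR h) => x y.
  by apply: estep_carry; rewrite ?dL.
apply: connect_trans reach; case: enu => enu; rewrite {nu}enu in h dnu subnu *.
  have nbmu : b \notin mu by apply: contra dL.1.1; apply: (subsetP subnu).
  have neb : e != b by apply: contraNneq nbmu => <-; rewrite (cornerW ce).
  have [x [x1 x2 dx xb]] := diag_next ebL de neb.
  have ex : cle e x by rewrite /cle x1 x2 !leqnSn.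
  have nxe : x != e by rewrite cell_eqE x1; apply/nandP; left; rewrite neq_ltn ltnSn orbT.
  have Hx c : c \in mu -> ~~ cle x c.
    move=> cmu; apply/negP => xc.
    have ec := corner_max ce cmu (cle_trans ex xc).
    by rewrite ec in xc; rewrite (cle_anti ex xc) eqxx in nxe.
  apply: (@connect_trans _ _ (x |: mu)); last first.
    by apply: slide => //; rewrite ?dL ?setU11.
  apply/connect1/estepP; exists e, x; split => //; first by rewrite (cornerW ce).
  - by apply: downsetP dL.2 _ _ xb _; rewrite setU11.
  - by move=> c cmu ec _; apply: corner_max ce cmu ec.
  by right.
rewrite -{1}(setD1K (cornerW ce).1.1).
apply: slide => //; rewrite ?dL ?setU11 // => c /setD1P[nce cmu].
by apply: contraNN nce => ec; rewrite (corner_max ce cmu ec).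
Qed.

Lemma connect_heckeE R S mu : growth R -> downset mu -> mu \subset [set x in R] ->
  connect (estep [set x in R]) mu S = hecke R S mu.
Proof.
move=> gR dmu sub; apply/idP/idP; last exact: hecke_connect.
move=> /connectP[p]; move: (hecke_refl gR dmu sub).
(* Only the start of the path is generalised; the partition to which the words evaluate stays
   [mu]. *)
move: {1 3 4}mu => x; elim: p x => [|y p IH] x h /=; first by move=> _ ->.
by case/andP => exy pyp; apply: IH pyp; apply: hecke_estep exy h.
Qed.

End Downsets.

(** * Boundary labels *)

Section RowLengths.
Set Implicit Arguments.
Unset Strict Implicit.
Variables d n : nat.
Local Notation cell := ('I_d * 'I_n)%type.
Implicit Types (a b c e f : cell) (M S A L X mu nu : {set cell}) (R : seq cell).
Local Open Scope nat_scope.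

Lemma card_ord_lt m k : #|[set i : 'I_m | i < k]| = minn k m.
Proof.
rewrite -sum1dep_card; have [le|lt] := leqP k m.
  by rewrite -(big_ord_widen m (fun=> 1)) // sum_nat_const card_ord muln1.
rewrite -[RHS]card_ord -sum1_card; apply: eq_bigl => i.
by rewrite (ltn_trans (ltn_ord i) lt).
Qed.

Lemma mem_initial_segment m (A : {set 'I_m}) (i : 'I_m) :
  (forall j k : 'I_m, j <= k -> k \in A -> j \in A) -> (i \in A) = (i < #|A|).
Proof.
move=> dA; have [iA|iA] := boolP (i \in A); apply/esym.
  have /subset_leq_card : [set j : 'I_m | j < i.+1] \subset A.
    by apply/subsetP => j; rewrite inE ltnS => /dA; apply.
  by rewrite card_ord_lt (minn_idPl (ltn_ord i)) => ->.
have /subset_leq_card : A \subset [set j : 'I_m | j < i].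
  apply/subsetP => j jA; rewrite inE ltnNge; apply: contra iA => le.
  exact: dA le jA.
by rewrite card_ord_lt (minn_idPl (ltnW (ltn_ord i))) ltnNge => ->.
Qed.

Definition rowlen M (r : 'I_d) : nat := #|[set c in M | c.1 == r]|.
Definition collen M (s : 'I_n) : nat := #|[set c in M | c.2 == s]|.

Lemma mem_rowlen M c : downset M -> (c \in M) = (c.2 < rowlen M c.1).
Proof.
move=> /downsetP dM; case: c => r s /=.
have -> : rowlen M r = #|[set s : 'I_n | (r, s) \in M]|.
  rewrite -(card_imset _ (f := fun s => (r, s))); last by move=> ? ? [].
  apply: eq_card => -[r1 s1]; rewrite !inE /=; apply/andP/imsetP => [[rs /eqP e]|].
    by exists s1; rewrite ?inE -e.
  by case=> s2; rewrite inE => rs2 [-> ->]; rewrite rs2 eqxx.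
rewrite -mem_initial_segment ?inE // => j k le; rewrite !inE.
by apply: dM; rewrite /cle leqnn.
Qed.

Lemma collenE M (s : 'I_n) : collen M s = #|[set r : 'I_d | (r, s) \in M]|.
Proof.
rewrite -(card_imset _ (f := fun r => (r, s))); last by move=> ? ? [].
apply: eq_card => -[r1 s1]; rewrite !inE /=; apply/andP/imsetP => [[rs /eqP e]|].
  by exists r1; rewrite ?inE -e.
by case=> s2; rewrite inE => rs2 [-> ->]; rewrite rs2 eqxx.
Qed.

Lemma mem_collen M c : downset M -> (c \in M) = (c.1 < collen M c.2).
Proof.
move=> /downsetP dM; case: c => r s /=; rewrite collenE.
rewrite -mem_initial_segment ?inE // => j k le; rewrite !inE.
by apply: dM; rewrite /cle leqnn andbT.
Qed.

Lemma rowlenU M A r : [disjoint M & A] ->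
  rowlen (M :|: A) r = rowlen M r + rowlen A r.
Proof.
move=> dMA; rewrite /rowlen -cardsUI.
rewrite (_ : _ :&: _ = set0) ?cards0 ?addn0.
  by apply: eq_card => c; rewrite !inE andb_orl.
apply/setP => c; rewrite !inE; case: (boolP (c \in M)) => //= cM.
by rewrite (disjointFr dMA cM) andbF.
Qed.

Lemma rowlen_setU1 M e r : e \notin M -> rowlen (e |: M) r = (e.1 == r) + rowlen M r.
Proof.
move=> eM; rewrite rowlenU ?disjoints1 //; congr (_ + _).
case: (eqVneq e.1 r) => er; last first.
  apply/eqP; rewrite cards_eq0; apply/eqP/setP => c; rewrite !inE.
  by case: eqVneq => // ->; rewrite (negPf er).
rewrite /rowlen (_ : [set _ in _ | _] = [set e]) ?cards1 //.
by apply/setP => c; rewrite !inE; case: (eqVneq c e) => // ->; rewrite er eqxx.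
Qed.

Lemma collen_setU1 M e s : e \notin M -> collen (e |: M) s = (e.2 == s) + collen M s.
Proof.
move=> eM; case: (eqVneq e.2 s) => es.
  rewrite /collen (cardsD1 e) !inE eqxx es eqxx; congr (_ + _).
  apply: eq_card => c; rewrite !inE; case: (eqVneq c e) => // ->.
  by rewrite (negPf eM).
apply: eq_card => c; rewrite !inE; case: (eqVneq c e) => // ->.
by rewrite (negPf eM) (negPf es).
Qed.

Lemma rowlen_addable M e : addable M e -> rowlen M e.1 = e.2.
Proof.
move=> ae; have := mem_rowlen e (addableW ae).1.2.
have := mem_rowlen e (addableW ae).2.
rewrite (negPf (addableW ae).1.1) setU11 rowlen_setU1 ?(addableW ae) // eqxx.
by clear; lia.
Qed.

Lemma collen_addable M e : addable M e -> collen M e.2 = e.1.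
Proof.
move=> ae; have := mem_collen e (addableW ae).1.2.
have := mem_collen e (addableW ae).2.
rewrite (negPf (addableW ae).1.1) setU11 collen_setU1 ?(addableW ae) // eqxx.
by clear; lia.
Qed.

(* The row and column positions label the steps of the boundary path of [M]; adding a
   cell exchanges two consecutive labels. *)
Definition rowpos M (r : 'I_d) : nat := rowlen M r + (d.-1 - r).
Definition colpos M (s : 'I_n) : nat := s + (d - collen M s).

Definition swap (k p : nat) : nat :=
  if p == k then k.+1 else if p == k.+1 then k else p.

Lemma rowpos_addable M e : addable M e -> rowpos M e.1 = diag e.
Proof. by move=> ae; rewrite /rowpos rowlen_addable. Qed.

Lemma collen_le M s : collen M s <= d.
Proof.
rewrite /collen -[leqRHS](card_ord d) -(@card_in_imset _ _ fst).
  exact: max_card.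
by move=> [a1 a2] [b1 b2]; rewrite !inE /= => /andP[_ /eqP->] /andP[_ /eqP->] ->.
Qed.

Lemma colpos_addable M e : addable M e -> colpos M e.2 = (diag e).+1.
Proof.
move=> ae; rewrite /colpos collen_addable // /diag.
by have := ltn_ord e.1; clear; lia.
Qed.

(** Only row [e.1] changes. No other row carries one of the two exchanged labels: rows above are
    longer than [e.2], rows below are not. *)
Lemma rowpos_setU1 M e r : addable M e ->
  rowpos (e |: M) r = swap (diag e) (rowpos M r).
Proof.
move=> ae; rewrite /swap {1}/rowpos rowlen_setU1 ?(addableW ae) //.
have [<-|ner] := eqVneq e.1 r; first by rewrite rowpos_addable // !eqxx rowlen_addable.
rewrite add0n -/(rowpos M r).
suff [-> ->] : (rowpos M r == diag e) = false /\ (rowpos M r == (diag e).+1) = false by [].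
rewrite /rowpos /diag.
have [lt|ge] := ltnP r e.1.
  have : (r, e.2) \in e |: M.
    by apply: (downsetP _ (addableW ae).2 _ e); rewrite ?setU11 // /cle /= ltnW /=.
  case/setU1P => [E|]; first by rewrite -E eqxx in ner.
  rewrite (mem_rowlen _ (addableW ae).1.2) /=.
  by have := ltn_ord e.1; move: lt; clear; lia.
have lt : e.1 < r by rewrite ltn_neqAle ge andbT; apply: contraNneq ner => /ord_inj->.
have : (r, e.2) \notin M.
  apply: contra (addableW ae).1.1; apply: downsetP (addableW ae).1.2 _ _ _.
  by rewrite /cle /= ltnW /=.
rewrite (mem_rowlen _ (addableW ae).1.2) /=.
by have := ltn_ord r; move: lt; clear; lia.
Qed.

Lemma colpos_setU1 M e s : addable M e ->
  colpos (e |: M) s = swap (diag e) (colpos M s).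
Proof.
move=> ae; rewrite /swap {1}/colpos collen_setU1 ?(addableW ae) //.
have [<-|ner] := eqVneq e.2 s.
  rewrite colpos_addable // eqxx (gtn_eqF (ltnSn _)) collen_addable // /diag.
  by have := ltn_ord e.1; clear; lia.
rewrite add0n -/(colpos M s).
suff [-> ->] : (colpos M s == diag e) = false /\ (colpos M s == (diag e).+1) = false by [].
have := collen_le M s; rewrite /colpos /diag.
have [lt|ge] := ltnP s e.2.
  have : (e.1, s) \in e |: M.
    by apply: (downsetP _ (addableW ae).2 _ e); rewrite ?setU11 // /cle /= leqnn /= ltnW.
  case/setU1P => [E|]; first by rewrite -E eqxx in ner.
  rewrite (mem_collen _ (addableW ae).1.2) /=.
  by have := ltn_ord e.1; move: lt; clear; lia.
have lt : e.2 < s by rewrite ltn_neqAle ge andbT; apply: contraNneq ner => /ord_inj->.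
have : (e.1, s) \notin M.
  apply: contra (addableW ae).1.1; apply: downsetP (addableW ae).1.2 _ _ _.
  by rewrite /cle /= leqnn ltnW.
rewrite (mem_collen _ (addableW ae).1.2) /=.
by have := ltn_ord e.1; move: lt; clear; lia.
Qed.

Lemma rowlen_le M r : rowlen M r <= n.
Proof.
rewrite /rowlen -[leqRHS](card_ord n) -(@card_in_imset _ _ snd).
  exact: max_card.
by move=> [a1 a2] [b1 b2]; rewrite !inE /= => /andP[_ /eqP->] /andP[_ /eqP->] ->.
Qed.

Lemma rowpos_dec M (r s : 'I_d) : downset M -> r < s -> rowpos M s < rowpos M r.
Proof.
move=> dM lt; have le : rowlen M s <= rowlen M r.
  apply: contraT; rewrite -ltnNge => lt'.
  have ltn : rowlen M r < n := leq_trans lt' (rowlen_le _ _).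
  have : (r, Ordinal ltn) \in M.
    apply: (downsetP _ dM _ (s, Ordinal ltn)); first by rewrite /cle /= leqnn ltnW.
    by rewrite mem_rowlen.
  by rewrite mem_rowlen //= ltnn.
by rewrite /rowpos; have := ltn_ord s; move: lt le; clear; lia.
Qed.

End RowLengths.

(** * The Chevalley rule *)

Section Pieri.
Set Implicit Arguments.
Unset Strict Implicit.
Variables (d n : nat) (F : fieldType).
Local Notation cell := ('I_d * 'I_n)%type.
Implicit Types (a b c e f : cell) (M S A B L mu nu : {set cell}) (R : seq cell).
Implicit Types (z : nat -> F).

Lemma sum_subset_setU1 (h : {set cell} -> F) e B : e \notin B ->
  \sum_(A : {set cell} | A \subset e |: B) h A =
  \sum_(A : {set cell} | A \subset B) (h A + h (e |: A)).
Proof.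
move=> eB; rewrite big_split /= (bigID (fun A : {set cell} => e \in A)) /= addrC.
congr (_ + _).
  apply: eq_bigl => A; apply/andP/idP => [[/subsetP sub eA]|sub].
    apply/subsetP => c cA; have /setU1P[ce|//] := sub _ cA.
    by rewrite ce (negPf eA) in cA.
  by rewrite subsetU ?sub ?orbT //; split => //; apply: contra eB; apply: (subsetP sub).
rewrite (reindex_onto (fun A => e |: A) (fun A => A :\ e)) /=; last first.
  by move=> A /andP[_ eA]; rewrite setD1K.
apply: eq_bigl => A; rewrite setU11 andbT; apply/andP/idP => [[sub /eqP eA]|sub].
  apply/subsetP => c cA; have /setU1P[ce|//] : c \in e |: B.
    by apply: (subsetP sub); rewrite inE cA orbT.
  by rewrite ce -eA setD11 in cA.
rewrite setUS // setU1K ?eqxx //.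
by apply: contra eB; apply: (subsetP sub).
Qed.

(** * Row products and the exchange of two parameters *)

Definition zswap (k : nat) z : nat -> F := fun p => z (swap k p).

Definition rowprod z M : F := \prod_(r < d) z (rowpos M r).

Lemma rowprod_swap z M e : addable M e ->
  rowprod (zswap (diag e) z) M = rowprod z (e |: M).
Proof. by move=> ae; apply: eq_bigr => r _; rewrite rowpos_setU1. Qed.

Lemma rowprod_add z M e : addable M e ->
  rowprod z (e |: M) * z (diag e) = rowprod z M * z (diag e).+1.
Proof.
move=> ae; rewrite /rowprod (bigD1 e.1) //= [in RHS](bigD1 e.1) //=.
rewrite rowpos_setU1 // rowpos_addable // /swap eqxx.
rewrite (eq_bigr (fun r => z (rowpos M r))); first by ring.
move=> r ner; congr z; rewrite /rowpos rowlen_setU1 ?(addableW ae) //.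
by rewrite eq_sym (negPf ner).
Qed.

(** The labels [k] and [k.+1] are either both row labels or both not, so the product is symmetric in
    the two parameters. The bound on [M] excludes an addable position that falls outside the finite
    grid. *)
Lemma rowprod_swap_neutral z L M b : addable L b -> downset M ->
    M \subset b |: L -> (forall e, diag e = diag b -> ~~ addable M e) ->
    (forall e, diag e = diag b -> ~~ corner M e) ->
  rowprod (zswap (diag b) z) M = rowprod z M.
Proof.
move=> ab dM sub noadd nocor; set k := diag b.
have uniq_pos r s : rowpos M r = rowpos M s -> r = s.
  move=> E; apply/eqP; case: (ltngtP r s) => [lt|lt|/ord_inj->//].
    by have := rowpos_dec dM lt; rewrite E ltnn.
  by have := rowpos_dec dM lt; rewrite E ltnn.
(* If no row had label [k.+1], the row above [r] would be strictly longer and the first free cell of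
   row [r] addable. *)
have up : [exists r, rowpos M r == k] -> [exists r, rowpos M r == k.+1].
  move=> /existsP[r /eqP rk]; apply: contraT => /existsPn none.
  have posE : (rowlen M r + (d.-1 - r) = b.2 + (d.-1 - b.1))%N by [].
  have lt_n : (rowlen M r < n)%N.
    (* A full row with label [k] lies below row [b.1] and forces [(r, b.2)], hence [b], into [L]. *)
    rewrite ltnNge; apply/negP => ge; have := (addableW ab).1.1; apply/negP/negPn.
    have lt_br : (b.1 < r)%N.
      by move: posE ge (ltn_ord b.1) (ltn_ord b.2) (ltn_ord r); clear; lia.
    have : (r, b.2) \in b |: L.
      by apply: (subsetP sub); rewrite mem_rowlen // (leq_trans (ltn_ord _) ge).
    case/setU1P => [E|]; first by rewrite -E ltnn in lt_br.
    apply: (downsetP _ (addableW ab).1.2).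
    by rewrite /cle /= leqnn (ltnW lt_br).
  pose e : 'I_d * 'I_n := (r, Ordinal lt_n).
  have /negP[] := noadd e rk.
  rewrite /addable dM mem_rowlen //= ltnn /=; apply/downsetP => a c.
  move=> le /setU1P[ce|cM]; last by rewrite inE (downsetP _ dM _ _ le cM) orbT.
  rewrite {c}ce in le; apply/setU1P.
  case/andP: le => /=; rewrite leq_eqVlt => /orP[/eqP/ord_inj a1|lt1 le2].
    rewrite leq_eqVlt => /orP[a2|lt2]; last by right; rewrite mem_rowlen // a1.
    by left; apply/eqP; rewrite cell_eqE a1 eqxx.
  right; have qd : (r.-1 < d)%N by rewrite (leq_ltn_trans (leq_pred _)).
  pose q := Ordinal qd.
  have qr : (q < r)%N by rewrite /= ltn_predL (leq_ltn_trans _ lt1).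
  have qpos : (k.+1 < rowpos M q)%N.
    by rewrite ltn_neqAle eq_sym none -rk rowpos_dec.
  apply: (downsetP _ dM _ (q, Ordinal lt_n)).
    by rewrite /cle /= le2 andbT; move: lt1; clear; lia.
  rewrite mem_rowlen //=; move: qpos; rewrite -rk /rowpos /=.
  by move: (ltn_ord r) qr => /=; clear; lia.
(* Dually, if no row had label [k], the last cell of row [r] would be a corner. *)
have down : [exists r, rowpos M r == k.+1] -> [exists r, rowpos M r == k].
  move=> /existsP[r /eqP rk]; apply: contraT => /existsPn none.
  have posE : (rowlen M r + (d.-1 - r) = (b.2 + (d.-1 - b.1)).+1)%N by [].
  have nextq (q : 'I_d) : q = r.+1 :> nat -> (rowlen M q < rowlen M r)%N.
    move=> qr; have ltq : (r < q)%N by rewrite qr.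
    have := rowpos_dec dM ltq; rewrite rk ltnS leq_eqVlt (negPf (none q)) /=.
    rewrite -ltnS -rk /rowpos qr; move: (ltn_ord q); rewrite qr; clear; lia.
  have gt0 : (0 < rowlen M r)%N.
    rewrite lt0n; apply/eqP => r0; rewrite r0 in posE nextq.
    have qd : (r.+1 < d)%N.
      by move: posE (ltn_ord b.1) (ltn_ord r); clear; lia.
    by have := nextq (Ordinal qd) (erefl _); rewrite ltn0.
  have lt_n : ((rowlen M r).-1 < n)%N.
    by rewrite (leq_trans _ (rowlen_le M r)) // prednK.
  pose e : 'I_d * 'I_n := (r, Ordinal lt_n).
  have /negP[] : ~~ corner M e.
    by apply: nocor; move: posE gt0; rewrite /diag /= /k /diag; clear; lia.
  apply: maximal_corner => //; first by rewrite mem_rowlen //= prednK.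
  move=> f fM /andP[/=]; rewrite leq_eqVlt => /orP[/eqP/ord_inj f1 le2|lt1 le2].
    apply: cle_anti; last by rewrite /cle /e /= -f1 le2 leqnn.
    rewrite mem_rowlen // -f1 in fM; rewrite /cle /e /= -f1 leqnn.
    by move: fM; clear; lia.
  have qd : (r.+1 < d)%N by rewrite (leq_ltn_trans lt1).
  have := nextq (Ordinal qd) (erefl _).
  have : (Ordinal qd, Ordinal lt_n) \in M.
    by apply: (downsetP _ dM _ f) => //; rewrite /cle /= lt1.
  by rewrite mem_rowlen //=; move: gt0; clear; lia.
have [/existsP[r /eqP rk]|nor] := boolP [exists r, rowpos M r == k].
  have /existsP[s /eqP sk] : [exists r, rowpos M r == k.+1].
    by apply: up; apply/existsP; exists r; rewrite rk.
  have nrs : s != r by apply: contra_eqN sk => /eqP->; rewrite rk neq_ltn ltnSn.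
  rewrite /rowprod (bigD1 r) //= (bigD1 s) //= [in RHS](bigD1 r) //= [in RHS](bigD1 s) //=.
  rewrite /zswap rk sk /swap !eqxx (gtn_eqF (ltnSn _)).
  rewrite (eq_bigr (fun r => z (rowpos M r))); first by ring.
  move=> i /andP[ir is_]; case: eqP => [ik|_].
    by case/eqP: ir; apply: uniq_pos; rewrite ik.
  case: eqP => [ik|//].
  by case/eqP: is_; apply: uniq_pos; rewrite ik.
apply: eq_bigr => i _; rewrite /zswap /swap; case: eqP => [ik|_].
  by case/existsP: nor; exists i; apply/eqP.
case: eqP => [ik|//].
by move: nor; rewrite down //; apply/existsP; exists i; apply/eqP.
Qed.

(** The coefficient [G(mu)] given by the recursion on the shape: the generator of diagonal [k]
    reaches [mu] only from [mu] and [mu :\ e]. The [pick] is unambiguous, since a diagonal holds at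
    most one corner. *)
Fixpoint groth R z mu : F :=
  if R is b :: R' then
    let z' := zswap (diag b) z in
    groth R' z' mu +
    if [pick e | corner mu e && (diag e == diag b)] is Some e then
      (z (diag b) / z (diag b).+1 - 1) * (groth R' z' mu + groth R' z' (mu :\ e))
    else 0
  else (mu == set0)%:R.

Definition cell_ratio z L c : F := z (colpos L c.2) / z (rowpos L c.1).

Lemma cell_ratio_setU1 z L b c : addable L b ->
  cell_ratio z (b |: L) c = cell_ratio (zswap (diag b) z) L c.
Proof. by move=> ab; rewrite /cell_ratio rowpos_setU1 // colpos_setU1. Qed.

Lemma cell_ratio_addable z L b : addable L b ->
  cell_ratio z (b |: L) b = z (diag b) / z (diag b).+1.
Proof.
move=> ab; rewrite cell_ratio_setU1 // /cell_ratio rowpos_addable // colpos_addable //.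
by rewrite /zswap /swap !eqxx (gtn_eqF (ltnSn _)).
Qed.

(** The sum splits according to whether the last cell [b] is chosen. Adding [b] to the shape changes
    the ratios of earlier cells exactly as [zswap] does, and by [hecke_inj] the predecessors [mu]
    and [mu :\ e] never share a subword. *)
Lemma grothE R z mu : growth R ->
  groth R z mu = \sum_(S : {set cell} | hecke R S mu)
    \prod_(c in S) (cell_ratio z [set x in R] c - 1).
Proof.
elim: R z mu => [|b R IH] z mu.
  move=> _ /=; have [_|ne] := eqVneq mu set0.
    by rewrite (eq_bigl (pred1 set0)) ?big_pred1_eq ?big_set0 // => S; rewrite andbT.
  by rewrite big_pred0 // => S; rewrite andbF.
case/growth_cons => gR ab _ /=.
rewrite (bigID (fun S : {set cell} => b \in S)) /= addrC set_cons.
have bR : b \notin R by have := (addableW ab).1.1; rewrite inE.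
congr (_ + _).
  rewrite IH //; apply: eq_big => [S|S _]; last first.
    by apply: eq_bigr => c _; rewrite cell_ratio_setU1.
  case: (boolP (b \in S)) => bS; rewrite ?andbF ?andbT //.
  by apply/negP => /hecke_notin/(_ bR); rewrite bS.
rewrite (reindex_onto (fun S => b |: S) (fun S => S :\ b)) /=; last first.
  by move=> S /andP[_ bS]; rewrite setD1K.
pose P S e := hecke R S mu || hecke R S (mu :\ e).
rewrite (eq_bigl (fun S => [exists e, [&& corner mu e, diag e == diag b & P S e]])); last first.
  move=> S; rewrite setU11 andbT; case: (boolP (b \in S)) => bS.
    rewrite [RHS]negbTE; last first.
      apply/existsP => -[e /and3P[_ _ /orP[]]] /hecke_notin/(_ bR); by rewrite bS.
    by apply/negbTE/nandP; right; apply: contraTneq bS => <-; rewrite setD11.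
  by rewrite setU1K // eqxx andbT.
case: pickP => [e /andP[ce /eqP de]|none]; last first.
  rewrite big_pred0 // => S; apply/existsP => -[e /and3P[ce de _]].
  by have := none e; rewrite ce de.
rewrite (eq_bigl (P^~ e)); last first.
  move=> S; apply/existsP/idP => [[f /and3P[cf /eqP df]]|PS].
    by rewrite (corner_diag_inj cf ce) // df.
  by exists e; rewrite ce de eqxx.
have prodE S : P S e -> \prod_(c in b |: S) (cell_ratio z (b |: [set x in R]) c - 1) =
    (z (diag b) / z (diag b).+1 - 1) *
     \prod_(c in S) (cell_ratio (zswap (diag b) z) [set x in R] c - 1).
  move=> PS; rewrite big_setU1; last by case/orP: PS => /hecke_notin; apply.
  by rewrite cell_ratio_addable //; congr (_ * _); apply: eq_bigr => c _; rewrite cell_ratio_setU1.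
rewrite (eq_bigr _ prodE) -big_distrr /=; congr (_ * _).
rewrite !IH // [RHS](bigID (fun S => hecke R S mu)) /=; congr (_ + _).
  by apply: eq_bigl => S; rewrite /P; case: (hecke R S mu); rewrite ?andbF.
apply: eq_bigl => S; rewrite /P; case: (boolP (hecke R S mu)) => h1 //=; last by rewrite andbT.
apply/negP => h2.
have /setP/(_ e) := hecke_inj h1 h2.
by rewrite setD11 (cornerW ce).
Qed.

Lemma groth_sub R z mu : growth R -> ~~ (mu \subset [set x in R]) -> groth R z mu = 0.
Proof.
move=> gR nsub; rewrite grothE // big_pred0 // => S; apply/negP => /(hecke_shape gR)[_ sub].
by rewrite sub in nsub.
Qed.

Lemma hecke_card R S mu : hecke R S mu -> (#|mu| <= #|S|)%N.
Proof.
elim: R S mu => [|b R IH] S mu; first by move=> /= /andP[_ /eqP->]; rewrite cards0.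
have [bS|bS] := boolP (b \in S); last by rewrite /= (negPf bS); apply: IH.
case/(hecke_consP _ _ bS) => e [ce _] [nu enu /IH].
rewrite (cardsD1 b S) bS (cardsD1 e mu) (cornerW ce).
case: enu => ->; last by rewrite leq_add2l.
by rewrite (cardsD1 e mu) (cornerW ce) => /leq_trans; apply.
Qed.

(** Each letter adds at most one box, so only the whole word reaches the full shape. *)
Lemma groth_top R z : growth R ->
  groth R z [set x in R] = \prod_(c in [set x in R]) (cell_ratio z [set x in R] c - 1).
Proof.
move=> gR; rewrite grothE // (eq_bigl (pred1 [set x in R])).
  by rewrite big_pred1_eq.
move=> S; apply/idP/eqP => [h|->]; last first.
  by apply: hecke_refl => //; apply: growth_downset.
by apply/eqP; rewrite eqEcard (hecke_sub h) (hecke_card h).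
Qed.

(** * Adding several boxes at once *)

Definition adds M : {set cell} := [set e | addable M e].

Lemma downset_adds M A : downset M -> A \subset adds M -> downset (M :|: A).
Proof.
move=> dM /subsetP sub; apply/downsetP => a b le /setUP[bM|bA].
  by rewrite inE (downsetP _ dM _ _ le bM).
have := sub _ bA; rewrite inE => ab.
have /setU1P[->|aM] := downsetP _ (addableW ab).2 _ _ le (setU11 _ _).
  by rewrite inE bA orbT.
by rewrite inE aM.
Qed.

Lemma addable_adds M A e : downset M -> addable M e -> A \subset adds M ->
  e \notin A -> addable (M :|: A) e.
Proof.
move=> dM ae sub eA; rewrite /addable !inE negb_or (addableW ae) eA /=.
rewrite downset_adds //= setUCA; apply: downset_adds => //.
by rewrite subUset sub1set sub inE ae.
Qed.

Lemma corner_adds M A e : corner M e -> A \subset adds M ->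
  {in A, forall a, ~~ cle e a} -> corner (M :|: A) e.
Proof.
move=> ce sub nle; have cM := cornerW ce.
apply: maximal_corner; first by rewrite downset_adds ?cM.
  by rewrite inE cM.
move=> f /setUP[fM|fA] ef; first exact: corner_max ce fM ef.
by rewrite (negPf (nle _ fA)) in ef.
Qed.

(** The cell [a] beyond [e] stops [e] and all earlier cells of its diagonal from being maximal. A
    later cell of that diagonal would have to be addable to [M], which would put a neighbour of [e]
    into [M]. *)
Lemma adds_no_corner M A e f : corner M e -> A \subset adds M ->
  (exists2 a, a \in A & cle e a) -> corner (M :|: A) f -> diag f <> diag e.
Proof.
move=> ce /subsetP sub [a aA ea] cf dfe.
have aM : a \notin M by have := sub _ aA; rewrite inE => /addableW ->.
have eM := (cornerW ce).1.1.
have fMA := (cornerW cf).1.1.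
case/orP: (diag_comparable dfe) => le.
  have af : a = f by apply: (corner_max cf) => //; [rewrite inE aA orbT|apply: cle_trans ea].
  by rewrite -af in le; rewrite (cle_anti le ea) eM in aM.
have [fM|fM] := boolP (f \in M).
  have fe := corner_max ce fM le.
  rewrite fe in cf; have ae : a = e by apply: (corner_max cf) => //; rewrite inE aA orbT.
  by rewrite ae eM in aM.
have fA : f \in A by move: fMA; rewrite inE (negPf fM).
have af : addable M f by have := sub _ fA; rewrite inE.
have nef : e != f by apply: contraNneq fM => <-.
have [c [ec cf' dc _]] := cle_cover le nef.
have /setU1P[cf''|cM] := downsetP _ (addableW af).2 _ _ cf' (setU11 _ _).
  by rewrite cf'' dfe eqxx in dc.
by rewrite (corner_max ce cM ec) eqxx in dc.
Qed.

Lemma corner_adds_inv M A f : downset M -> A \subset adds M ->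
  corner (M :|: A) f -> corner M f || addable M f.
Proof.
move=> dM /subsetP sub cf; have /setUP[fM|fA] := (cornerW cf).1.1; last first.
  by have := sub _ fA; rewrite inE => ->; rewrite orbT.
rewrite maximal_corner // => g gM fg; apply: (corner_max cf) => //.
by rewrite inE gM.
Qed.

(** Deleting [e] frees its own place and blocks just the addable cells resting on it. This aligns
    the sums over [mu :\ e] and [mu] in the corner case of [groth_pieri]. *)
Lemma adds_setD1 M e : corner M e ->
  adds (M :\ e) = e |: [set a in adds M | ~~ cle e a].
Proof.
move=> ce; have cM := cornerW ce; apply/setP => a; rewrite !inE.
have [->|nae] := eqVneq a e; first by rewrite addable_setD1.
apply/idP/andP => [aa|[aa nle]].
  have aM : a \notin M by have := (addableW aa).1.1; rewrite !inE nae.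
  have nle : ~~ cle e a.
    apply/negP => le; have := downsetP _ (addableW aa).2 _ _ le (setU11 _ _).
    by rewrite !inE eqxx eq_sym (negPf nae).
  split => //; rewrite /addable aM cM.
  rewrite (_ : a |: M = (a |: M :\ e) :|: M); first by rewrite downsetU ?(addableW aa) ?cM.
  by rewrite -setUA; congr (_ |: _); apply/esym/setUidPr/subD1set.
have aM := addableW aa.
have cae : corner (a |: M) e.
  apply: maximal_corner; rewrite ?aM //; first by rewrite !inE cM orbT.
  move=> f /setU1P[->|fM] ef; first by rewrite ef in nle.
  exact: corner_max ce fM ef.
rewrite /addable !inE negb_and aM orbT cM /=.
rewrite (_ : a |: M :\ e = (a |: M) :\ e) ?(cornerW cae) //.
apply/setP => c; rewrite !inE; case: (eqVneq c a) => [->|_]; rewrite ?nae //.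
Qed.

Lemma groth_corner R b z mu e : corner mu e -> diag e = diag b ->
  groth (b :: R) z mu =
  (z (diag b) / z (diag b).+1) * groth R (zswap (diag b) z) mu +
  (z (diag b) / z (diag b).+1 - 1) * groth R (zswap (diag b) z) (mu :\ e).
Proof.
move=> ce de /=; case: pickP => [f /andP[cf /eqP df]|/(_ e)]; last by rewrite ce de eqxx.
by rewrite (corner_diag_inj cf ce) ?df //; ring.
Qed.

Lemma groth_no_corner R b z mu : (forall e, diag e = diag b -> ~~ corner mu e) ->
  groth (b :: R) z mu = groth R (zswap (diag b) z) mu.
Proof.
move=> nc /=; case: pickP => [f /andP[cf /eqP df]|_]; last by rewrite addr0.
by have := nc _ df; rewrite cf.
Qed.

Arguments groth : simpl never.

(** The Chevalley rule, by induction on the word for all [z] at once, because the hypothesis is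
    applied to the swapped parameters [z']. Three cases arise on the diagonal [k] of the last
    box. *)
Lemma groth_pieri R z mu : (forall p, z p != 0) -> growth R -> downset mu ->
  rowprod z mu * groth R z mu =
  rowprod z [set x in R] * \sum_(A : {set cell} | A \subset adds mu) groth R z (mu :|: A).
Proof.
elim: R z mu => [|b R IH] z mu z0.
  move=> _ dmu; rewrite /groth; have [->|ne] := eqVneq mu set0.
    rewrite set_nil (bigD1 set0) ?sub0set //= set0U eqxx big1 ?addr0 // => A /andP[_ An].
    by rewrite set0U (negPf An).
  rewrite big1 ?mulr0 // => A _; rewrite setU_eq0 (negPf ne) //.
move=> gbR dmu; have [gR ab _] := growth_cons gbR.
set k := diag b; set z' := zswap k z; set L := [set x in R].
have z'0 p : z' p != 0 by apply: z0.
have ZL : rowprod z [set x in b :: R] = rowprod z' L.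
  by rewrite set_cons -rowprod_swap.
have IHz nu := IH z' nu z'0 gR.
rewrite ZL; set ZR := rowprod z' L in IHz *.
(* Addable cell: the terms of [A] and [e |: A] add up to [z k / z k.+1] times the corresponding
   terms for [z'], and the same factor relates the row products of [mu]. *)
have [/existsP[e /andP[ae /eqP de]]|noadd] := boolP [exists e, addable mu e && (diag e == k)].
  have eB : e \notin adds mu :\ e by rewrite setD11.
  have addsE : adds mu = e |: (adds mu :\ e) by rewrite setD1K // inE.
  rewrite groth_no_corner; last first.
    by move=> f df; apply/negP => /(addable_not_corner ae); rewrite df de.
  have Za : rowprod z mu = z k / z k.+1 * rowprod z' mu.
    have := rowprod_add z ae; rewrite -rowprod_swap // de => E.
    by apply: (mulIf (z0 k.+1)); rewrite -E mulrAC divfK // mulrC.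
  rewrite Za -mulrA (IHz _ dmu) mulrCA; congr (_ * _).
  rewrite addsE !sum_subset_setU1 // mulr_sumr; apply: eq_bigr => A sub.
  have [eA subA] : e \notin A /\ A \subset adds mu.
    split; last exact: subset_trans sub (subD1set _ _).
    by apply: contra eB; apply: (subsetP sub).
  have aA := addable_adds dmu ae subA eA.
  rewrite [in RHS]groth_no_corner; last first.
    by move=> f df; apply/negP => /(addable_not_corner aA); rewrite df de.
  rewrite setUCA (groth_corner _ _ (corner_setU1 aA)) // setU1K ?(addableW aA) //.
  by rewrite -/k -/z'; ring.
(* Corner: the induction hypothesis is used at both [mu] and [mu :\ e]. For [A] inside [B] the cell
   [e] stays a corner of [mu :|: A]; any other [A] covers [e], and no corner is left on the
   diagonal. *)
have [/existsP[e /andP[ce /eqP de]]|nocor] := boolP [exists e, corner mu e && (diag e == k)].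
  set M := mu :\ e; set B := [set a in adds mu | ~~ cle e a].
  have aM : addable M e := addable_setD1 ce.
  have Mmu : e |: M = mu by rewrite setD1K ?(cornerW ce).
  have ZM : rowprod z mu = rowprod z' M by rewrite -Mmu -rowprod_swap // de.
  have Zmu : rowprod z mu * (z k / z k.+1) = rowprod z' mu.
    have := rowprod_add z' aM; rewrite Mmu -ZM de.
    rewrite /z' /zswap /swap eqxx (gtn_eqF (ltnSn _)) eqxx => E.
    by apply: (mulIf (z0 k.+1)); rewrite E -mulrA divfK.
  rewrite (groth_corner _ _ ce) // -/k -/z' -/M mulrDr mulrA Zmu (IHz _ dmu).
  rewrite mulrCA ZM (IHz _ (addableW aM).1.2) -/ZR mulrCA -mulrDr; congr (_ * _).
  have eB : e \notin B by rewrite !inE cle_refl andbF.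
  rewrite adds_setD1 // -/B sum_subset_setU1 //.
  have subB : B \subset adds mu by apply/subsetP => a; rewrite !inE => /andP[].
  have -> : \sum_(A : {set cell} | A \subset B)
        (groth R z' (M :|: A) + groth R z' (M :|: (e |: A)))
      = \sum_(A : {set cell} | A \subset adds mu)
          (if A \subset B then groth R z' (M :|: A) + groth R z' (mu :|: A) else 0).
    rewrite [RHS](bigID (fun A : {set cell} => A \subset B)) /= [X in _ + X]big1 ?addr0; last first.
      by move=> A /andP[_ /negPf->].
    apply: eq_big => [A|A sub]; last by rewrite sub setUCA setUA Mmu.
    by apply/idP/andP => [sub|[]//]; rewrite (subset_trans sub).
  rewrite mulr_sumr -big_split /=; apply: eq_bigr => A sub.
  have [/subsetP sAB|nsub] := boolP (A \subset B).
    have cA : corner (mu :|: A) e.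
      by apply: corner_adds => // a /sAB; rewrite inE => /andP[].
    rewrite (groth_corner _ _ cA) //.
    have -> : (mu :|: A) :\ e = M :|: A.
      rewrite setDUl; congr (_ :|: _); apply/setP => c; rewrite !inE.
      by case: eqVneq => // ->; apply/esym/negbTE; apply: contra eB; apply: sAB.
    by rewrite -/k -/z'; ring.
  rewrite mulr0 addr0 groth_no_corner // => f df; apply/negP => cf.
  have [] := adds_no_corner ce sub _ cf; last by rewrite de.
  case/subsetPn: nsub => a aA; rewrite !inE => aB; exists a => //.
  have := subsetP sub _ aA; rewrite inE => aa.
  by rewrite aa /= negbK in aB.
(* Neither: the row product ignores the swap and no [mu :|: A] acquires a corner on the diagonal.
   When [mu] is not inside the shape, both sides vanish. *)
have noadd' e : diag e = diag b -> ~~ addable mu e.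
  by move=> de; apply: contra noadd => ae; apply/existsP; exists e; rewrite ae de eqxx.
have nocor' e : diag e = diag b -> ~~ corner mu e.
  by move=> de; apply: contra nocor => ae; apply/existsP; exists e; rewrite ae de eqxx.
have [sub|nsub] := boolP (mu \subset b |: L); last first.
  rewrite groth_sub // ?set_cons // big1 ?mulr0 // => A _.
  rewrite groth_sub // set_cons; apply: contra nsub; apply: subset_trans.
  exact: subsetUl.
rewrite -(rowprod_swap_neutral z ab dmu sub) //.
rewrite groth_no_corner // IHz //; congr (_ * _); apply: eq_bigr => A subA.
rewrite groth_no_corner // => f df; apply/negP => /(corner_adds_inv dmu subA).
by rewrite (negPf (nocor' _ df)) (negPf (noadd' _ df)).
Qed.

End Pieri.

(** * Diagrams and tableaux of the statement *)

Section Tableaux.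
Set Implicit Arguments.
Unset Strict Implicit.
Variables (d : nat) (la : seq nat).
Local Notation n := (nth 0%N la 0).
Local Notation cell := (Defs.cell d la).
Local Notation filling := (Defs.filling d la).
Implicit Types (a b c e f : cell) (M S A D : {set cell}) (mu nu s : seq nat).
Implicit Types (T : filling).
Local Open Scope nat_scope.

Definition weakly_decreasing s : Prop :=
  forall i j, i <= j -> nth 0 s j <= nth 0 s i.

Definition below s : Prop := forall i, nth 0 s i <= nth 0 la i.

Definition diagram s : {set cell} := [set c : cell | c.2 < nth 0 s c.1].

Lemma is_part_decreasing s : is_part s -> weakly_decreasing s.
Proof.
case/andP => ss _ i j le; have [ltj|gej] := ltnP j (size s); last by rewrite nth_default.
apply: (sorted_leq_nth _ _ 0 ss); rewrite ?inE //.
- by move=> x y z /= xy yz; apply: leq_trans yz xy.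
- by move=> x /=.
exact: leq_ltn_trans le ltj.
Qed.

Lemma subpart_below mu : subpart mu la -> below mu.
Proof.
case/andP => _ /allP H i; have [lt|ge] := ltnP i (size mu); last by rewrite nth_default.
by apply: H; rewrite mem_iota.
Qed.

Lemma diagram_downset s : weakly_decreasing s -> downset (diagram s).
Proof.
move=> ds; apply/downsetP => a b /andP[le1 le2]; rewrite !inE => lt.
exact: leq_ltn_trans le2 (leq_trans lt (ds _ _ le1)).
Qed.

Lemma diagram_sub mu : below mu -> diagram mu \subset diagram la.
Proof. by move=> le; apply/subsetP => c; rewrite !inE => /leq_trans; apply. Qed.

(** The square with opposite corners [a] and [b] lies in the diagram as soon as [b] does, so the
    three freeness conditions say that [a] is the only cell of [S] in it. *)
Lemma exc_stepE S S' : weakly_decreasing la ->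
  exc_step d la S S' = estep (diagram la) S S'.
Proof.
move=> dla; have dL := diagram_downset dla.
apply/existsP/estepP.
  case=> a /andP[aS /andP[act /existsP[b /andP[/andP[/eqP b1 /eqP b2] E]]]].
  case/andP: act => /andP[/andP[_ F1] F2] F3.
  have bL : b \in diagram la by move: F3; rewrite inE b1 b2 => /andP[/andP[_]].
  exists a, b; split => //.
    move=> c cS; rewrite /cle b1 b2 => /andP[a1 a2] /andP[c1 c2].
    have nomem i j : free_at d la S i j -> val c.1 = i -> val c.2 = j -> False.
      move=> /andP[_ /existsP F] e1 e2; case: F; exists c.
      by rewrite cS e1 e2 !eqxx.
    have [e1|n1] := eqVneq (val c.1) a.1; have [e2|n2] := eqVneq (val c.2) a.2.
    - by apply/eqP; rewrite cell_eqE -e1 -e2 !eqxx.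
    - by case: (nomem _ _ F2) => //; apply/eqP; move: a2 c2 n2 => /=; clear; lia.
    - by case: (nomem _ _ F1) => //; apply/eqP; move: a1 c1 n1 => /=; clear; lia.
    by case: (nomem _ _ F3); apply/eqP; [move: a1 c1 n1|move: a2 c2 n2] => /=; clear; lia.
  by case/orP: E => /eqP; [left|right].
case=> a [b [aS bL [b1 b2] H E]]; exists a; rewrite aS /=.
have ab : cle a b by rewrite /cle b1 b2 !leqnSn.
have free i j : a.1 <= i <= b.1 -> a.2 <= j <= b.2 -> (i, j) != (val a.1, val a.2) ->
    free_at d la S i j.
  move=> /andP[ai ib] /andP[aj jb] ne; apply/andP; split.
    apply/andP; split; first exact: leq_ltn_trans ib (ltn_ord _).
    by move: bL; rewrite inE => lt; apply: leq_ltn_trans jb (leq_trans lt (dla _ _ ib)).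
  apply/existsP => -[c /and3P[cS /eqP c1 /eqP c2]].
  have := H c cS; rewrite /cle /= -!c1 -!c2 in ai ib aj jb ne *.
  by rewrite ai aj ib jb => /(_ isT isT) ca; rewrite ca eqxx in ne.
have neS k : (k.+1 == k) = false by rewrite gtn_eqF.
rewrite /active aS !free ?b1 ?b2 ?leqnn ?leqnSn //= ?xpair_eqE ?neS ?andbF //.
apply/existsP; exists b; rewrite b1 b2 !eqxx /=.
by case: E => ->; rewrite eqxx ?orbT.
Qed.

Lemma mem_excited (R : seq cell) mu D : growth R -> [set c in R] = diagram la ->
    weakly_decreasing la -> weakly_decreasing mu -> below mu ->
  (D \in excited d la mu) = hecke R D (diagram mu).
Proof.
move=> gR eR dla dmu le; rewrite inE -connect_heckeE ?eR ?diagram_sub //; last first.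
  exact: diagram_downset.
by apply: eq_connect => S S'; apply: exc_stepE.
Qed.

(** This list has length [d] and may end in zeros, so shapes are handled through [weakly_decreasing]
    and [below] rather than [is_part]. *)
Definition of_shape M : seq nat := [seq rowlen M r | r <- enum 'I_d].

Lemma nth_of_shape M (r : 'I_d) : nth 0 (of_shape M) r = rowlen M r.
Proof.
by rewrite (nth_map r) ?size_enum_ord // nth_ord_enum.
Qed.

Lemma of_shape_default M i : d <= i -> nth 0 (of_shape M) i = 0.
Proof. by move=> le; rewrite nth_default // size_map size_enum_ord. Qed.

Lemma diagram_of_shape M : downset M -> diagram (of_shape M) = M.
Proof.
by move=> dM; apply/setP => c; rewrite inE nth_of_shape -mem_rowlen.
Qed.

Lemma rowlen_diagram s (r : 'I_d) : weakly_decreasing s -> below s ->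
    weakly_decreasing la -> rowlen (diagram s) r = nth 0 s r.
Proof.
move=> ds le dla; have le1 := rowlen_le (diagram s) r.
have le2 : nth 0 s r <= n by apply: leq_trans (le r) (dla _ _ _).
have H (j : 'I_n) : (j < nth 0 s r) = (j < rowlen (diagram s) r).
  by have := mem_rowlen (r, j) (diagram_downset ds); rewrite inE.
apply/eqP; rewrite eqn_leq; apply/andP; split; apply: contraT; rewrite -ltnNge => lt.
  by have := H (Ordinal (leq_trans lt le1)); rewrite /= lt ltnn.
by have := H (Ordinal (leq_trans lt le2)); rewrite /= lt ltnn.
Qed.

Lemma of_shape_decreasing M : downset M -> weakly_decreasing (of_shape M).
Proof.
move=> dM i j le; have [ltj|gej] := ltnP j d; last by rewrite of_shape_default.
have lti := leq_ltn_trans le ltj.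
rewrite (nth_of_shape M (Ordinal ltj)) (nth_of_shape M (Ordinal lti)).
move: le; rewrite leq_eqVlt => /orP[/eqP E|lt].
  by rewrite leq_eqVlt; apply/orP; left; apply/eqP; congr rowlen; apply/val_inj.
have := @rowpos_dec _ _ M (Ordinal lti) (Ordinal ltj) dM lt.
rewrite /rowpos /= => H; apply: contraT; rewrite -ltnNge => lt'.
have ltn : rowlen M (Ordinal lti) < n := leq_trans lt' (rowlen_le _ _).
have : (Ordinal lti, Ordinal ltn) \in M.
  apply: (downsetP _ dM _ (Ordinal ltj, Ordinal ltn)).
    by rewrite /cle /= leqnn ltnW.
  by rewrite mem_rowlen.
by rewrite mem_rowlen //= ltnn.
Qed.

Lemma of_shape_below M : weakly_decreasing la -> downset M ->
  M \subset diagram la -> below (of_shape M).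
Proof.
move=> dla dM sub i; have [lti|gei] := ltnP i d; last by rewrite of_shape_default.
rewrite (nth_of_shape M (Ordinal lti)); apply: contraT; rewrite -ltnNge => lt.
have ltn : nth 0 la i < n := leq_trans lt (rowlen_le _ _).
have : (Ordinal lti, Ordinal ltn) \in diagram la.
  by apply: (subsetP sub); rewrite mem_rowlen.
by rewrite inE /= ltnn.
Qed.

Definition tableau mu T : Prop :=
  [/\ forall c, (0 < T c) = in_skew d la mu c,
      forall c c', in_skew d la mu c -> in_skew d la mu c' ->
        cle c c' -> c != c' -> T c < T c'
    & forall k, 0 < k <= mSIT d la mu T -> exists c, T c = k :> nat].

Lemma skewE mu c : in_skew d la mu c = (c \in diagram la :\: diagram mu).
Proof. by rewrite !inE andbC. Qed.

Lemma leq_mSIT mu T c : in_skew d la mu c -> T c <= mSIT d la mu T.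
Proof. exact: (@leq_bigmax_cond _ (in_skew d la mu) (fun c => val (T c))). Qed.

Lemma is_SITP mu T : weakly_decreasing la -> weakly_decreasing mu ->
  reflect (tableau mu T) (is_SIT d la mu T).
Proof.
move=> dla dmu; apply: (iffP idP).
  case/andP => /andP[/andP[/andP[/forallP H1 /forallP H2] /forallP H3] /forallP H4] /forallP H5.
  have row c c' : in_skew d la mu c -> in_skew d la mu c' -> c.1 = c'.1 -> c.2 < c'.2 -> T c < T c'.
    by move=> sc sc' e lt; have /forallP/(_ c') := H3 c; rewrite sc sc' e eqxx lt.
  have col c c' : in_skew d la mu c -> in_skew d la mu c' -> c.2 = c'.2 -> c.1 < c'.1 -> T c < T c'.
    by move=> sc sc' e lt; have /forallP/(_ c') := H4 c; rewrite sc sc' e eqxx lt.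
  split.
  - move=> c; apply/idP/idP => [|sc]; last by have := H2 c; rewrite sc.
    by apply: contraTT => nsc; have := H1 c; rewrite nsc /= -leqNgt leqn0.
  - move=> c c' sc sc' /andP[le1 le2] ne.
    (* Growth along rows and columns gives growth in the product order, via the intermediate cell
       [x], which again lies in the skew shape. *)
    pose x : cell := (c.1, c'.2).
    have sx : in_skew d la mu x.
      move: sc sc'; rewrite !skewE !inE => /andP[n1 _] /andP[_ l2] /=.
      rewrite (leq_trans l2 (dla _ _ le1)) andbT; move: n1; rewrite -!leqNgt => n1.
      exact: leq_trans n1 le2.
    move: le1 le2; rewrite leq_eqVlt => /orP[/eqP/ord_inj e1|lt1].
      rewrite leq_eqVlt => /orP[/eqP/ord_inj e2|lt2]; last exact: row.
      by case/eqP: ne; case: (c) (c') e1 e2 => ? ? [? ?] /= -> ->.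
    rewrite leq_eqVlt => /orP[/eqP/ord_inj e2|lt2]; first exact: col.
    by apply: (@ltn_trans (T x)); [apply: row|apply: col].
  move=> k /andP[k0 km].
  have kN : k < NSIT d la.
    apply: leq_ltn_trans km _; rewrite /mSIT ltnS; apply/bigmax_leqP => c _.
    by rewrite -ltnS; apply: ltn_ord.
  have := H5 (Ordinal kN); rewrite /= k0 km /= => /existsP[c /andP[_ /eqP E]].
  by exists c; rewrite E.
case=> P1 P2 P3; rewrite /is_SIT -!andbA; apply/and5P; split; apply/forallP => c.
- apply/implyP => nsc; have := P1 c; rewrite (negPf nsc) => /negbT.
  by rewrite -eqn0Ngt.
- by apply/implyP; rewrite -P1.
- apply/forallP => c'; apply/implyP => /andP[/andP[/andP[sc sc'] /eqP e] lt].
  apply: P2 => //; first by rewrite /cle e leqnn ltnW.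
  by apply: contraTneq lt => ->; rewrite ltnn.
- apply/forallP => c'; apply/implyP => /andP[/andP[/andP[sc sc'] /eqP e] lt].
  apply: P2 => //; first by rewrite /cle e leqnn ltnW.
  by apply: contraTneq lt => ->; rewrite ltnn.
apply/implyP => km; have [c' e] := P3 _ km; apply/existsP; exists c'.
have -> : T c' == c by rewrite -val_eqE /= e.
by rewrite andbT -P1 e; case/andP: km.
Qed.

End Tableaux.

(** * Removing the entries 1 from an increasing tableau *)

Section Peeling.
Set Implicit Arguments.
Unset Strict Implicit.
Variables (d : nat) (la mu : seq nat).
Hypotheses (dla : weakly_decreasing la) (dmu : weakly_decreasing mu).
Hypothesis mu_la : below la mu.
Local Notation n := (nth 0%N la 0).
Local Notation cell := (Defs.cell d la).
Local Notation filling := (Defs.filling d la).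
Implicit Types (a b c e f : cell) (M S A D : {set cell}).
Implicit Types (T : filling).
Local Open Scope nat_scope.

Local Notation M := (diagram d la mu).
Local Notation L := (diagram d la la).
Local Notation skew := (in_skew d la mu).

Let dM : downset M := diagram_downset d la dmu.
Let dL : downset L := diagram_downset d la dla.

(** The possible supports of the entry 1. Addability refers to the whole grid, hence the separate
    inclusion in [L]. *)
Definition strip A : bool := [&& A \subset adds M, A \subset L & A != set0].
Definition grow A : seq nat := of_shape (M :|: A).

Definition first_strip T : {set cell} := [set c | T c == 1 :> nat].

Definition peel T : filling := [ffun c => @inord (d * n) (T c).-1].

(** Cells of the removed strip carry 0 in the smaller tableau and receive 1 here. *)
Definition unpeel T : filling :=
  [ffun c => @inord (d * n) (if skew c then (T c).+1 else 0)].

Lemma peelE T c : peel T c = (T c).-1 :> nat.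
Proof. by rewrite ffunE inordK // (leq_ltn_trans (leq_pred _)) ?ltn_ord. Qed.

Lemma grow_diagram A : strip A -> diagram d la (grow A) = M :|: A.
Proof. by case/and3P => sub _ _; rewrite diagram_of_shape // downset_adds. Qed.

Lemma grow_decreasing A : strip A -> weakly_decreasing (grow A).
Proof. by case/and3P => sub _ _; apply/of_shape_decreasing/downset_adds. Qed.

Lemma grow_below A : strip A -> below la (grow A).
Proof.
case/and3P => sub subL _; apply: of_shape_below => //; first exact: downset_adds.
by rewrite subUset subL diagram_sub.
Qed.

Lemma strip_skew A c : strip A -> c \in A -> skew c.
Proof.
case/and3P => /subsetP sub /subsetP subL _ cA; rewrite skewE inE subL // andbT.
by have := sub c cA; rewrite inE => /addableW->.
Qed.

Lemma grow_skew A c : strip A -> in_skew d la (grow A) c = skew c && (c \notin A).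
Proof.
by move=> sA; rewrite !skewE grow_diagram // !inE negb_or andbAC.
Qed.

Lemma tableau_gt0 T c : tableau mu T -> (0 < T c) = skew c.
Proof. by case. Qed.

(** A skew cell strictly before one with entry 1 would need a positive entry below 1, so all
    predecessors lie in [M]. *)
Lemma first_strip_strip T : tableau mu T -> M != L -> strip (first_strip T).
Proof.
move=> tT neML; have [T1 T2 T3] := tT.
have sk c : c \in first_strip T -> skew c by rewrite inE -T1 => /eqP->.
have sL c : skew c -> c \in L by rewrite skewE => /setDP[].
apply/and3P; split.
- apply/subsetP => c cA; have sc := sk c cA; rewrite inE /addable dM.
  have : c \notin M by move: sc; rewrite skewE => /setDP[].
  move=> -> /=; apply/downsetP => a b le /setU1P[E|bM]; last first.
    by rewrite inE (downsetP _ dM _ _ le bM) orbT.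
  rewrite {b}E in le; apply/setU1P; have [->|ne] := eqVneq a c; [by left|right].
  apply: contraT => aM; have sa : skew a.
    by rewrite skewE inE aM (downsetP _ dL _ _ le (sL _ sc)).
  have := T2 _ _ sa sc le ne; have := T1 a; rewrite sa; move: cA.
  by rewrite inE => /eqP-> T0; rewrite ltnS leqNgt T0.
- by apply/subsetP => c /sk /sL.
have /existsP[c sc] : [exists c, skew c].
  apply: contraNT neML => /existsPn H; rewrite eqEsubset diagram_sub //=.
  apply/subsetP => c cL; apply: contraT => cM.
  by have := H c; rewrite skewE inE cL cM.
have [|c1 c1E] := T3 1; last by apply/set0Pn; exists c1; rewrite inE c1E.
by rewrite /=; apply: leq_trans (leq_mSIT T sc); rewrite T1.
Qed.

Lemma mSIT_peel T A : tableau mu T -> strip A -> A = first_strip T ->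
  mSIT d la mu T = (mSIT d la (grow A) (peel T)).+1.
Proof.
move=> tT sA eA; have [T1 T2 T3] := tT.
apply/eqP; rewrite eqn_leq; apply/andP; split.
  apply/bigmax_leqP => c sc; have [cA|cA] := boolP (c \in A).
    by move: cA; rewrite eA inE /= => /eqP->.
  have sc' : in_skew d la (grow A) c by rewrite grow_skew // sc.
  have := leq_mSIT (peel T) sc'; rewrite peelE.
  by move=> /= ?; rewrite -(prednK (n := T c)) ?T1.
have m0 : 0 < mSIT d la mu T.
  case/and3P: (sA) => _ _ /set0Pn[c cA].
  apply: leq_trans (leq_mSIT T (strip_skew sA cA)).
  by move: cA; rewrite eA inE => /eqP->.
rewrite -(prednK m0) ltnS; apply/bigmax_leqP => c; rewrite grow_skew // => /andP[sc _].
by rewrite /= peelE -!subn1 leq_sub2r ?leq_mSIT.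
Qed.

Lemma tableau_peel T A : tableau mu T -> strip A -> A = first_strip T ->
  tableau (grow A) (peel T).
Proof.
move=> tT sA eA; have mE := mSIT_peel tT sA eA; have [T1 T2 T3] := tT.
have gt1 c : skew c -> c \notin A -> 1 < T c.
  by rewrite -T1 eA inE => ? ne; rewrite ltn_neqAle eq_sym ne.
split.
- move=> c; rewrite peelE grow_skew //; apply/idP/andP => [lt|[sc cA]].
    split; first by rewrite -T1; move: lt; clear; lia.
    by rewrite eA inE; apply: contraTneq lt => ->.
  by have := gt1 _ sc cA; clear; lia.
- move=> c c'; rewrite !grow_skew // !peelE => /andP[sc cA] /andP[sc' cA'] le ne.
  by have := T2 _ _ sc sc' le ne; have := gt1 _ sc cA; clear; lia.
move=> k /andP[k0 km]; have [|c cE] := T3 k.+1; first by rewrite mE.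
by exists c; rewrite peelE cE.
Qed.

Lemma unpeel_peel T : tableau mu T -> unpeel (peel T) = T.
Proof.
move=> tT; apply/ffunP => c; rewrite ffunE peelE; apply/val_inj; rewrite /= inordK.
  by rewrite -(tableau_gt0 _ tT); case: (ltnP 0 (T c)) => [/prednK|]; rewrite ?leqn0 // => /eqP.
by rewrite -(tableau_gt0 _ tT); case: ifP => [/prednK->|//]; apply: ltn_ord.
Qed.

(** Guards [unpeel] against overflow of the ordinal range: the values [1..m] are all taken on cells
    other than [a], whose entry is 0. *)
Lemma mSIT_lt nu T A : strip A -> nu = grow A -> tableau nu T ->
  mSIT d la nu T < d * n.
Proof.
move=> sA -> [T1 T2 T3]; case/and3P: (sA) => _ _ /set0Pn[a aA].
pose m := mSIT d la (grow A) T.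
have sub : [set k : 'I_m.+1 | 0 < k] \subset [set inord (T c) | c : cell & c != a].
  apply/subsetP => k; rewrite inE => k0.
  have [|c cE] := T3 k; first by rewrite k0 -ltnS ltn_ord.
  apply/imsetP; exists c; last by apply/val_inj; rewrite /= cE inord_val.
  rewrite inE; apply: contraTneq k0 => ca; rewrite -cE ca T1 grow_skew // aA andbF.
  by [].
have := leq_trans (subset_leq_card sub) (leq_imset_card _ _).
have -> : #|[set k : 'I_m.+1 | 0 < k]| = m.
  have := cardsC [set k : 'I_m.+1 | 0 < k]; rewrite card_ord.
  rewrite (_ : ~: _ = [set ord0]) ?cards1 ?addn1; first by case.
  by apply/setP => k; rewrite !inE -leqNgt leqn0.
rewrite -/m => le; apply: leq_ltn_trans le _.
have := cardC1 a; rewrite card_prod !card_ord => H.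
have ca : 0 < #|{: cell}| by apply/card_gt0P; exists a.
rewrite cardsE [X in X < _](_ : _ = (d * n).-1).
  by rewrite card_prod !card_ord in ca; rewrite prednK.
by rewrite -H; apply: eq_card => c; rewrite !inE.
Qed.

Lemma unpeelE T A c : strip A -> tableau (grow A) T ->
  unpeel T c = (if skew c then (T c).+1 else 0) :> nat.
Proof.
move=> sA tT; rewrite ffunE inordK //; case: ifP => // sc; rewrite ltnS.
apply: leq_ltn_trans (mSIT_lt sA (erefl _) tT); have [T1 _ _] := tT.
case: (boolP (in_skew d la (grow A) c)) => [/leq_mSIT->//|].
by rewrite -T1 -eqn0Ngt => /eqP->.
Qed.

Lemma first_strip_unpeel T A : strip A -> tableau (grow A) T ->
  first_strip (unpeel T) = A.
Proof.
move=> sA tT; have [T1 _ _] := tT; apply/setP => c; rewrite inE (unpeelE _ sA tT).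
have := T1 c; rewrite grow_skew //; case: (boolP (c \in A)) => cA.
  by rewrite (strip_skew sA cA) andbF => /negbT; rewrite -eqn0Ngt eqSS.
by case: ifP => // _ /=; rewrite lt0n eqSS => /negPf.
Qed.

Lemma peel_unpeel T A : strip A -> tableau (grow A) T -> peel (unpeel T) = T.
Proof.
move=> sA tT; have [T1 _ _] := tT; apply/ffunP => c; apply/val_inj.
rewrite /= peelE (unpeelE _ sA tT); case: ifP => // sc.
by have := T1 c; rewrite grow_skew // sc => /negbT; rewrite -eqn0Ngt => /eqP.
Qed.

Lemma tableau_unpeel T A : strip A -> tableau (grow A) T ->
  tableau mu (unpeel T).
Proof.
move=> sA tT; have [T1 T2 T3] := tT; have uE c := unpeelE c sA tT.
case/and3P: (sA) => /subsetP subA _ /set0Pn[a aA].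
split.
- by move=> c; rewrite uE; case: ifP.
- move=> c c' sc sc' le ne; rewrite !uE sc sc' ltnS.
  have cA' : c' \notin A.
    apply/negP => /subA; rewrite inE => ac'.
    have := downsetP _ (addableW ac').2 _ _ le (setU11 _ _).
    move: sc; rewrite skewE => /setDP[_ /negPf cM] /setU1P[E|]; last by rewrite cM.
    by rewrite E eqxx in ne.
  have sc2 : in_skew d la (grow A) c' by rewrite grow_skew // sc'.
  have [cA|cA] := boolP (c \in A).
    have := T1 c; rewrite grow_skew // cA andbF => /negbT.
    by rewrite -eqn0Ngt => /eqP->; rewrite T1.
  by apply: T2 => //; rewrite grow_skew // sc.
move=> k /andP[k0 km].
case: k k0 km => // k _; case: k => [|k] km.
  exists a; rewrite uE (strip_skew sA aA); congr _.+1.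
  by have := T1 a; rewrite grow_skew // aA andbF => /negbT; rewrite -eqn0Ngt => /eqP.
have [|c cE] := T3 k.+1; last first.
  exists c; rewrite uE cE; have := T1 c; rewrite cE grow_skew //.
  by case: (skew c).
rewrite /=; suff : mSIT d la mu (unpeel T) <= (mSIT d la (grow A) T).+1 by move/(leq_trans km).
apply/bigmax_leqP => c sc; rewrite /= uE sc ltnS.
case: (boolP (in_skew d la (grow A) c)) => [/leq_mSIT->//|].
by rewrite -T1 -eqn0Ngt => /eqP->.
Qed.

Lemma nuT_first T (r : 'I_d) : tableau mu T -> nuT d la mu T 1 r = nth 0 mu r.
Proof.
case=> T1 _ _; rewrite /nuT (_ : [set _ | _] = set0) ?cards0 ?addn0 //.
apply/setP => c; rewrite !inE; apply/negP => /andP[/andP[sc _]].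
by rewrite -T1 in sc; rewrite /= ltnS leqNgt sc.
Qed.

(** The cells with entry 1 move from the counted entries to the inner shape; [0 < k] ensures that
    they were counted. *)
Lemma nuT_peel T A k (r : 'I_d) : tableau mu T -> strip A -> A = first_strip T ->
  0 < k -> nuT d la mu T k.+1 r = nuT d la (grow A) (peel T) k r.
Proof.
move=> tT sA eA k0; have [T1 T2 T3] := tT.
rewrite /nuT nth_of_shape rowlenU; last first.
  rewrite disjoint_sym disjoints_subset; apply/subsetP => c cA; rewrite inE.
  by have := strip_skew sA cA; rewrite skewE => /setDP[].
rewrite rowlen_diagram // -addnA; congr (_ + _).
rewrite -(cardsID A); congr (_ + _).
  apply: eq_card => c; rewrite !inE; case: (boolP (c \in A)) => cA; rewrite ?andbF ?andbT //.
  rewrite (strip_skew sA cA) /=; move: cA; rewrite eA inE => /eqP->.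
  by rewrite ltnS k0 andbT.
apply: eq_card => c; rewrite !inE grow_skew //= peelE.
case: (boolP (c \in A)) => cA; rewrite ?andbF ?andbT //=.
case: (boolP (skew c)) => //= sc; congr (_ && _).
by move: sc k0; rewrite -T1; clear; lia.
Qed.

End Peeling.

(** * Weighted sums over increasing tableaux *)

Section SITSum.
Set Implicit Arguments.
Unset Strict Implicit.
Variables (d : nat) (la : seq nat) (F : fieldType) (w : ('I_d -> nat) -> F).
Hypothesis w_ext : forall g h, g =1 h -> w g = w h.
Hypothesis dla : weakly_decreasing la.
Implicit Type (mu : seq nat).

Definition sit_weight mu (T : filling d la) : F :=
  \prod_(1 <= k < (mSIT d la mu T).+1) w (fun r => nuT d la mu T k r).

Definition sit_sum mu : F :=
  \sum_(T : filling d la | is_SIT d la mu T) sit_weight mu T.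

Lemma sit_sum_full mu : diagram d la mu = diagram d la la -> sit_sum mu = 1.
Proof.
move=> E; have nosk c : in_skew d la mu c = false.
  by rewrite skewE E setDv inE.
have m0 T : mSIT d la mu T = 0%N.
  by rewrite /mSIT big_pred0.
pose T0 : filling d la := [ffun=> ord0].
rewrite /sit_sum (eq_bigl (pred1 T0)).
  by rewrite big_pred1_eq /sit_weight m0 big_geq.
move=> T; rewrite /is_SIT m0 /=; apply/idP/eqP => [|->].
  move=> /andP[/andP[/andP[/andP[/forallP H _] _] _] _].
  apply/ffunP => c; apply/val_inj; rewrite /= ffunE.
  by have := H c; rewrite nosk => /eqP.
rewrite -!andbA; apply/and5P; split; apply/forallP => c; rewrite ?nosk ?ffunE //.
- by apply/forallP => c'; rewrite nosk.
- by apply/forallP => c'; rewrite nosk.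
by apply/implyP => /andP[k1 k2]; move: (leq_trans k1 k2).
Qed.

(** Tableaux are grouped by the support of the entry 1. The factor [k = 1] depends on [mu] alone;
    the others are those of the peeled tableau, shifted by one. *)
Lemma sit_sum_peel mu : weakly_decreasing mu -> below la mu ->
    diagram d la mu != diagram d la la ->
  sit_sum mu = w (fun r => nth 0%N mu r) *
    \sum_(A : {set Defs.cell d la} | strip mu A) sit_sum (grow mu A).
Proof.
move=> dmu mu_la ne.
rewrite /sit_sum (partition_big (@first_strip d la) (@strip d la mu)) /=; last first.
  by move=> T /(is_SITP _ dla dmu) tT; apply: first_strip_strip.
rewrite mulr_sumr; apply: eq_bigr => A sA.
have dnu := grow_decreasing dmu sA.
rewrite (reindex_onto (@unpeel d la mu) (@peel d la)) /=; last first.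
  by move=> T /andP[/(is_SITP _ dla dmu) tT _]; apply: unpeel_peel.
rewrite mulr_sumr; apply: eq_big => [T|T].
  apply/andP/(is_SITP _ dla dnu) => [[/andP[/(is_SITP _ dla dmu) tT /eqP eA] /eqP eT]|tT].
    by rewrite -eT; apply: tableau_peel.
  rewrite (first_strip_unpeel dmu sA tT) (peel_unpeel dmu sA tT) !eqxx andbT.
  by split => //; apply/(is_SITP _ dla dmu); apply: (tableau_unpeel _ sA tT).
move=> /andP[/andP[/(is_SITP _ dla dmu) tT /eqP eA] /eqP eT].
have eA' := esym eA.
rewrite /sit_weight (mSIT_peel dmu tT sA eA') eT.
rewrite big_nat_recl //; congr (_ * _).
  by apply: w_ext => r; apply: nuT_first.
apply: eq_big_nat => k /andP[k1 _].
by apply: w_ext => r; rewrite (nuT_peel dla dmu mu_la _ tT sA eA' k1) eT.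
Qed.

End SITSum.

(** * Comparison of the two sides *)

Section Comparison.
Set Implicit Arguments.
Unset Strict Implicit.
Variables (d : nat) (la : seq nat) (F : fieldType) (z : nat -> F).
Variable R : seq (Defs.cell d la).
Local Notation L := (diagram d la la).
Hypotheses (dla : weakly_decreasing la) (gR : growth R) (eR : [set c in R] = L).
Hypothesis z0 : forall p, z p != 0.
Hypothesis rowprod_neq : forall M : {set Defs.cell d la},
  downset M -> M \proper L -> rowprod z M != rowprod z L.
Hypothesis top0 : groth R z L != 0.

Definition row_weight (g : 'I_d -> nat) : F :=
  (\prod_(r < d) z (g r + (d.-1 - r)) / rowprod z L - 1)^-1.

(** Both sides obey one recursion: moving the term [A = set0] of the Chevalley rule to the left
    leaves the factor [rowprod z M / rowprod z L - 1], the inverse of the tableau weight. *)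
Lemma sit_sum_groth mu : weakly_decreasing mu -> below la mu ->
  @sit_sum d la F row_weight mu = groth R z (diagram d la mu) / groth R z L.
Proof.
have [m] := ubnP #|L :\: diagram d la mu|; elim: m mu => // m IH mu lt dmu mu_la.
have [E|ne] := eqVneq (diagram d la mu) L.
  by rewrite sit_sum_full // E divff.
have w_ext g h : g =1 h -> row_weight g = row_weight h.
  by move=> gh; rewrite /row_weight; congr (_ / _ - 1)^-1; apply: eq_bigr => r _; rewrite gh.
rewrite sit_sum_peel //; set M := diagram d la mu.
have dM : downset M by apply: diagram_downset.
have subM : M \subset L by apply: diagram_sub.
have step (A : {set Defs.cell d la}) : strip mu A ->
    @sit_sum d la F row_weight (grow mu A) = groth R z (M :|: A) / groth R z L.
  move=> sA; rewrite IH ?grow_diagram //.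
  - rewrite -ltnS; apply: leq_trans lt; rewrite ltnS; apply/proper_card/properP; split.
      by apply/setDS/subsetUl.
    case/and3P: sA => /subsetP sub /subsetP subL /set0Pn[a aA]; exists a.
      by rewrite inE subL // andbT; have := sub a aA; rewrite inE => /addableW->.
    by rewrite !inE aA orbT.
  - exact: grow_decreasing.
  exact: grow_below.
rewrite (eq_bigr _ step) -mulr_suml mulrA; congr (_ / _).
have Pieri := groth_pieri z0 gR dM; rewrite eR in Pieri.
rewrite (bigD1 set0) ?sub0set //= setU0 in Pieri.
(* Sets of addable cells that leave [la] contribute 0, as [groth] vanishes on shapes outside [L]. *)
have sumE :
    \sum_(A : {set Defs.cell d la} | (A \subset adds M) && (A != set0))
      groth R z (M :|: A) =
    \sum_(A | strip mu A) groth R z (M :|: A).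
  rewrite (bigID (fun A : {set Defs.cell d la} => A \subset L)) /= [X in _ + X]big1 ?addr0.
    by apply: eq_bigl => A; rewrite /strip -andbA [(A != _) && _]andbC.
  move=> A /andP[_ nsub]; apply: groth_sub => //; rewrite eR.
  by apply: contra nsub; apply: subset_trans; apply: subsetUr.
rewrite {}sumE in Pieri.
rewrite /row_weight.
have -> : \prod_(r < d) z (nth 0%N mu r + (d.-1 - r)) = rowprod z M.
  by apply: eq_bigr => r _; rewrite /rowpos rowlen_diagram.
set s := \sum_(A | _) _ in Pieri *.
have L0 : rowprod z L != 0 by apply/prodf_neq0 => r _; apply: z0.
have nML : rowprod z M - rowprod z L != 0.
  by rewrite subr_eq0 rowprod_neq // properEneq ne.
have -> : s = groth R z M * (rowprod z M / rowprod z L - 1).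
  apply: (mulfI L0); rewrite mulrBr mulr1 mulrBr mulrCA [rowprod z L * (_ / _)]mulrC.
  by rewrite divfK // [_ * rowprod z M]mulrC Pieri; ring.
rewrite mulrC mulfK //.
by rewrite -(divff L0) -mulrBl mulf_neq0 ?invr_eq0.
Qed.

End Comparison.

(** * Size and column lengths of the diagram *)

Section Shapes.
Set Implicit Arguments.
Unset Strict Implicit.
Variables (d : nat) (la : seq nat).
Hypotheses (dla : weakly_decreasing la) (size_la : (size la <= d)%N).
Local Notation L := (diagram d la la).

Lemma card_diagram : #|L| = sumn la.
Proof.
rewrite -sum1_card.
rewrite (eq_bigl (fun c : Defs.cell d la => true && (c.2 < nth 0 la c.1)%N)); last first.
  by move=> c; rewrite inE.
rewrite -(pair_big_dep xpredT
  (fun (r : 'I_d) (s : 'I_(nth 0%N la 0)) => (s < nth 0 la r)%N) (fun _ _ => 1%N)) /=.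
rewrite (eq_bigr (fun r : 'I_d => nth 0%N la r)); last first.
  by move=> r _; rewrite sum1dep_card card_ord_lt; apply/minn_idPl/dla.
rewrite sumnE (big_nth 0%N) big_mkord.
rewrite (big_ord_widen _ (fun i => nth 0%N la i) size_la) big_mkcond [RHS]big_mkcond /=.
by apply: eq_bigr => r _; case: ltnP => // ?; rewrite nth_default.
Qed.

Lemma collen_conjp (s : 'I_(nth 0%N la 0)) : collen L s = conjp la s.+1.
Proof.
rewrite collenE /conjp -sum1_count (big_nth 0%N) big_mkord -sum1dep_card.
rewrite (big_ord_widen_cond _ (fun i => s < nth 0 la i)%N (fun=> 1%N) size_la).
apply: eq_bigl => r; rewrite inE /=; case: (ltnP r (size la)) => [_|ge]; rewrite ?andbT //.
by rewrite [nth _ _ r]nth_default.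
Qed.

End Shapes.

(** * Nonvanishing in the field of rational functions *)

Definition pq (p : nat) : {poly {poly rat}} := 1 + 'X%:P * 'X^(p.+1).

Definition zq (p : nat) : RF := 1 + beta * qv ^+ p.+1.

Lemma zqE p : zq p = tofrac (pq p).
Proof. by rewrite /zq /beta /qv /pq rmorphD rmorphM rmorphXn rmorph1. Qed.

(* Setting [q = 2] and [beta = 1] detects that the denominators do not vanish. *)
Definition eval21 (P : {poly {poly rat}}) : rat := P.[2%:R%:P].[1].

Lemma eval21_pq p : eval21 (pq p) = 1 + 2%:R ^+ p.+1.
Proof. by rewrite /eval21 /pq !hornerE. Qed.

Lemma eval21_pq_gt0 p : 0 < eval21 (pq p).
Proof. by rewrite eval21_pq addr_gt0 ?exprn_gt0. Qed.

Lemma tofrac_neq0 P : eval21 P != 0 -> tofrac P != 0 :> RF.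
Proof. by rewrite tofrac_eq0; apply: contraNneq => ->; rewrite /eval21 !horner0. Qed.

Lemma zq_neq0 p : zq p != 0.
Proof. by rewrite zqE tofrac_neq0 // gt_eqF ?eval21_pq_gt0. Qed.

Lemma beta_neq0 : beta != 0.
Proof. by rewrite tofrac_neq0 // /eval21 !hornerE oner_eq0. Qed.

Lemma qv_neq0 : qv != 0.
Proof. by rewrite tofrac_neq0 // /eval21 !hornerE. Qed.

Lemma one_sub_qv_neq0 h : (0 < h)%N -> 1 - qv ^+ h != 0.
Proof.
move=> h0; have -> : 1 - qv ^+ h = tofrac (1 - 'X^h).
  by rewrite /qv rmorphB rmorph1 rmorphXn.
apply: tofrac_neq0.
rewrite /eval21 !hornerE subr_eq0 eq_sym gt_eqF //.
by rewrite exprn_egt1 -?lt0n.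
Qed.

(** At [q = 2] and [beta = 1] the factors are positive and strictly increasing in the label, and a
    proper subdiagram has a smaller label in some row. *)
Lemma rowprod_zq_neq d n (M L : {set 'I_d * 'I_n}) :
  downset M -> downset L -> M \proper L -> rowprod zq M != rowprod zq L.
Proof.
move=> dM dL /properP[sub [c cL cM]].
have E (X : {set 'I_d * 'I_n}) : rowprod zq X = tofrac (\prod_r pq (rowpos X r)).
  by rewrite rmorph_prod; apply: eq_bigr => r _; apply: zqE.
have evE (X : {set 'I_d * 'I_n}) :
    eval21 (\prod_r pq (rowpos X r)) = \prod_r eval21 (pq (rowpos X r)).
  by rewrite /eval21 !horner_prod.
rewrite !E tofrac_eq; apply/eqP => /(congr1 eval21)/eqP; rewrite !evE; apply/negP.
have le r : (rowpos M r <= rowpos L r)%N.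
  rewrite leq_add2r; apply: subset_leq_card; apply/subsetP => x; rewrite !inE.
  by case/andP => /(subsetP sub)->.
have le_ev p1 p2 : (p1 <= p2)%N -> eval21 (pq p1) <= eval21 (pq p2).
  by move=> le12; rewrite !eval21_pq lerD2l ler_weXn2l.
have lt : eval21 (pq (rowpos M c.1)) < eval21 (pq (rowpos L c.1)).
  rewrite !eval21_pq ltrD2l ltr_eXn2l // ltnS ltn_add2r.
  by move: cM; rewrite mem_rowlen // -leqNgt => /leq_ltn_trans; apply; rewrite -mem_rowlen.
rewrite (bigD1 c.1) //= [X in _ == X](bigD1 c.1) //= lt_eqF //.
apply: (@lt_le_trans _ _ (eval21 (pq (rowpos L c.1)) *
                          \prod_(r | r != c.1) eval21 (pq (rowpos M r)))).
  by rewrite ltr_pM2r // prodr_gt0 // => r _; apply: eval21_pq_gt0.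
rewrite ler_wpM2l ?(ltW (eval21_pq_gt0 _)) // ler_prod // => r _.
by rewrite (ltW (eval21_pq_gt0 _)) le_ev.
Qed.

(** * Hooks and the factor of a single cell *)

Section Factors.
Set Implicit Arguments.
Unset Strict Implicit.
Variables (d : nat) (la : seq nat).
Hypotheses (dla : weakly_decreasing la) (size_la : (size la <= d)%N).
Local Notation L := (diagram d la la).

(** The hook length is the distance, along the boundary path, between the steps that end the row and
    the column of [c]. *)
Lemma rowpos_hook (c : Defs.cell d la) : c \in L ->
  rowpos L c.1 = (colpos L c.2 + hook la c.1.+1 c.2.+1)%N.
Proof.
move=> cL; have dL : downset L by apply: diagram_downset.
have H1 := cL; rewrite mem_rowlen // in H1; have H2 := cL; rewrite mem_collen // in H2.
have := collen_le L c.2; move: H1 H2.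
rewrite /rowpos /colpos /hook rowlen_diagram // -(collen_conjp size_la) //=.
by have := ltn_ord c.1; clear; lia.
Qed.

Lemma cell_ratio_hook (c : Defs.cell d la) : c \in L ->
  cell_ratio zq L c - 1 =
  beta * (qv ^+ (colpos L c.2).+1 * (1 - qv ^+ hook la c.1.+1 c.2.+1)) / zq (rowpos L c.1).
Proof.
move=> cL; have z0 := zq_neq0 (rowpos L c.1).
rewrite /cell_ratio -[X in _ - X](divff z0) -mulrBl; congr (_ / _).
by rewrite rowpos_hook // /zq -addSn exprD; ring.
Qed.

Lemma cell_ratio_sub1_neq0 (c : Defs.cell d la) : c \in L -> cell_ratio zq L c - 1 != 0.
Proof.
move=> cL; rewrite cell_ratio_hook //.
apply: mulf_neq0; last by rewrite invr_eq0 zq_neq0.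
apply: (mulf_neq0 beta_neq0); apply: mulf_neq0.
  exact: (expf_neq0 _ qv_neq0).
by apply: one_sub_qv_neq0; rewrite /hook addn1.
Qed.

Lemma cell_factor (c : Defs.cell d la) : c \in L ->
  (beta * qv ^+ (nth 0 la c.1 + (d - c.1))%N + 1)
        / (qv ^ ((d + c.2.+1)%:Z - (conjp la c.2.+1)%:Z)
           * (1 - qv ^+ (hook la c.1.+1 c.2.+1))) = beta / (cell_ratio zq L c - 1).
Proof.
move=> cL; rewrite cell_ratio_hook //.
(* The integer exponent is a natural number because no column is longer than [d]. *)
have -> : (d + c.2.+1)%:Z - (conjp la c.2.+1)%:Z = (colpos L c.2).+1%:Z.
  rewrite /colpos -(collen_conjp size_la) // subzn; last first.
    exact: leq_trans (collen_le _ _) (leq_addr _ _).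
  by have := collen_le L c.2; move=> le; congr Posz; move: le; clear; lia.
have -> : beta * qv ^+ (nth 0 la c.1 + (d - c.1))%N + 1 = zq (rowpos L c.1).
  rewrite addrC /zq /rowpos rowlen_diagram //; congr (1 + beta * qv ^+ _).
  by have := ltn_ord c.1; clear; lia.
rewrite -exprnP; set u := qv ^+ _ * _.
by rewrite invf_div [in RHS]invfM [in RHS]mulrCA mulVKf ?beta_neq0.
Qed.

End Factors.

Theorem theorem6p6 (d : nat) (la mu : seq nat) :
  (1 <= d)%N -> is_part la -> is_part mu -> subpart mu la -> (size la <= d)%N ->
  \sum_(T : filling d la | is_SIT d la mu T)
     \prod_(1 <= k < (mSIT d la mu T).+1)
       ((\prod_(r < d)
           ((1 + beta * qv ^+ (nuT d la mu T k r + (d - r))%N)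
            / (1 + beta * qv ^+ (nth 0 la r + (d - r))%N))) - 1)^-1
  =
  \sum_(D in excited d la mu)
     beta ^ ((#|D|)%:Z - (sumn la)%:Z) *
     \prod_(c : cell d la | in_la d la c && (c \notin D))
       ((beta * qv ^+ (nth 0 la c.1 + (d - c.1))%N + 1)
        / (qv ^ ((d + c.2.+1)%:Z - (conjp la c.2.+1)%:Z)
           * (1 - qv ^+ (hook la c.1.+1 c.2.+1)))).
Proof.
move=> _ pla pmu smu sla.
have dla := is_part_decreasing pla; have dmu := is_part_decreasing pmu.
have mu_la := subpart_below smu.
set L := diagram d la la; have dL : downset L by apply: diagram_downset.
have [R gR eR] := growth_exists dL.
have top : groth R zq L = \prod_(c in L) (cell_ratio zq L c - 1).
  by rewrite -eR groth_top.
have top0 : groth R zq L != 0.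
  by rewrite top; apply/prodf_neq0 => c; apply: cell_ratio_sub1_neq0.
(* The exponents agree since [d.-1 - r] in the label and the extra 1 in [zq] make up [d - r]. *)
transitivity (@sit_sum d la _ (row_weight la zq) mu).
  apply: eq_bigr => T _; apply: eq_bigr => k _; congr (_ - 1)^-1.
  rewrite prodf_div; congr (_ / _); apply: eq_bigr => r _; rewrite /zq.
    by congr (1 + beta * qv ^+ _); have := ltn_ord r; clear; lia.
  rewrite /rowpos rowlen_diagram //.
  by congr (1 + beta * qv ^+ _); have := ltn_ord r; clear; lia.
rewrite (sit_sum_groth dla gR eR zq_neq0 _ top0) //; last first.
  by move=> M dM; apply: rowprod_zq_neq.
rewrite grothE // eR mulr_suml; apply: eq_big => [D|D hD].
  by rewrite (mem_excited _ gR eR).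
have sub : D \subset L by rewrite -/L -eR; apply: hecke_sub hD.
rewrite [X in _ = _ * X](eq_bigl (fun c => c \in L :\: D)); last first.
  by move=> c; rewrite inE inE andbC.
rewrite [X in _ = _ * X](eq_bigr (fun c => beta / (cell_ratio zq L c - 1))); last first.
  by move=> c; rewrite in_setD => /andP[_ cL]; apply: cell_factor.
(* Dividing by the value at the full shape cancels the cells of [D] and leaves reciprocals over
   [L :\: D]. *)
have -> : groth R zq L = \prod_(c in D) (cell_ratio zq L c - 1) *
    \prod_(c in L :\: D) (cell_ratio zq L c - 1).
  by rewrite top (big_setID D) /= (setIidPr sub).
rewrite [in RHS]prodf_div prodr_const.
(* The power of [beta] in front cancels the [beta] in each factor of [L :\: D]. *)
have -> : (#|D|%:Z - (sumn la)%:Z) = - #|L :\: D|%:Z.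
  by rewrite -(card_diagram dla sla) -/L -(cardsID D L) (setIidPr sub) PoszD opprD addNKr.
rewrite -exprnN mulrA mulVf ?expf_neq0 ?beta_neq0 //.
have D0 : \prod_(c in D) (cell_ratio zq L c - 1) != 0.
  by apply/prodf_neq0 => c /(subsetP sub); apply: cell_ratio_sub1_neq0.
by rewrite mul1r invfM mulrA divff // mul1r.
Qed.
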